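(* Let $\mathcal{O}=(\mathfrak{G},\mathfrak{G}_{\mathrm{int}},\tilde L)$ be a cut-and-project scheme such that $L$ is finitely generated, let $W\subset\mathfrak{G}_{\mathrm{int}}$ be a window such that the model set $\Lambda_{\mathcal{O}}(W)$ is finitely periodic, and let $\{X_s\}_{s\in\Lambda_{\mathcal{O}}(W)}$ be a complex-valued finitely randomized model set on $\Lambda_{\mathcal{O}}(W)$. Let $\theta$ be the Haar measure of $\mathfrak{G}_{\mathrm{int}}$ and $\{D_n\}_n$ the fixed van Hove sequence of $\mathfrak{G}$. Then there are a cut-and-project subscheme $\mathcal{S}=(\mathfrak{G},\mathfrak{H}_{\mathrm{int}},\tilde M)$ of $\mathcal{O}$ and a finite complete system of representatives $R=\{r_C\in L : C\in L/M\}$ of $L/M$ (with $r_C\in C$) such that the following holds. For each $g\in\Lambda_{\mathcal{O}}(W)-\Lambda_{\mathcal{O}}(W)$, each $C\in L/M$, each $r\in R$ with $r\equiv g \bmod M$, and each nonnegative integer $k\le \ell:=\ell_{\Lambda_{\mathcal{O}}(W)}(g-r)$, there is a relatively compact set $V_{C,k}\subseteq (W-r_C^\star)\cap\mathfrak{H}_{\mathrm{int}}$ such that for $$S_{C,k}:=r_C+\Lambda_{\mathcal{S}}(V_{C,k})$$ we have: (1) the family $\{X_s\overline{X_{s-g}} : s\in S_{C,k},\ s-g\in\Lambda_{\mathcal{O}}(W)\}$ of random variables is independent; and (2) if $\theta(\partial W)=0$, then the density $\lim_{n\to\infty}\#(S_{C,k}\cap D_n)/|D_n|$ exists. Furthermore,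 (for each such $g$ and $r$) $\Lambda_{\mathcal{O}}(W)$ is the disjoint union of all the sets $S_{C,k}$ ($C\in L/M$, $0\le k\le\ell$).
   Context: LCAG means locally compact, $\sigma$-compact Abelian Hausdorff group. $\mathfrak{G},\mathfrak{G}_{\mathrm{int}}$ are LCAGs with fixed Haar measures; $|A|$ is the Haar measure of $A$. Cut-and-project scheme: a triple $(\mathfrak{G},\mathfrak{G}_{\mathrm{int}},\tilde L)$ where $\tilde L$ is a lattice (discrete cocompact subgroup) of $\mathfrak{G}\times\mathfrak{G}_{\mathrm{int}}$ such that the canonical projection $\Pi:\mathfrak{G}\times\mathfrak{G}_{\mathrm{int}}\to\mathfrak{G}$ is injective on $\tilde L$ and the image of $\tilde L$ under the other projection $\Pi_{\mathrm{int}}$ is dense in $\mathfrak{G}_{\mathrm{int}}$. Put $L:=\Pi(\tilde L)$ and, for $s\in L$, $s^\star:=\Pi_{\mathrm{int}}((\Pi|_{\tilde L})^{-1}(s))$ (the star map); similarly $M=\Pi(\tilde M)$. For a subset $W$ of the internal space of a scheme $\mathcal{S}$ with lattice $\tilde L$, $\Lambda_{\mathcal{S}}(W):=\{\Pi(x): x\in\tilde L,\ \Pi_{\mathrm{int}}(x)\in W\}$. A window is a nonempty, measurable, relatively compact subset of the internal space; $\Lambda(W)$ with $W$ a window is a model set. Cut-and-project subscheme of $(\mathfrak{G},\mathfrak{G}_{\mathrm{int}},\tilde L)$: a cut-and-project scheme $(\mathfrak{G},\mathfrak{H}_{\mathrm{int}},\tilde M)$ with $\tilde M\subset\tilde L$,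 $\mathfrak{H}_{\mathrm{int}}\subset\mathfrak{G}_{\mathrm{int}}$ (a subgroup), and the topology of $\mathfrak{H}_{\mathrm{int}}$ being the relative topology from $\mathfrak{G}_{\mathrm{int}}$. Dependency set (d-set) of a random field $\{X_s\}_{s\in S}$ on a discrete set $S$: a set $D=-D\subset S-S$ such that for any finite $P,Q\subset S$ with $(P-Q)\cap D=\emptyset$, the random vectors $(X_s)_{s\in P}$ and $(X_s)_{s\in Q}$ are independent. (Then $0\in D$.) A finitely randomized model set on a model set $\Lambda$ is a random field $\{X_s\}_{s\in\Lambda}$ that has a finite d-set. Finitely periodic: for a subset $A$ of an LCAG $H$, $x\in H$, $s\in A$, let $\ell_A(x;s)=0$ if $x=0$, and otherwise let $\ell_A(x;s)$ be the maximum $k\in\mathbb{Z}_{\ge0}\cup\{\infty\}$ such that $\{s-nx : 0\le n\le k\}\subset A$. Set $\ell_A(x):=\max_{s\in A}\ell_A(x;s)$. $A$ is finitely periodic if $\ell_A(x)<\infty$ for all $x\in A-A$. Van Hove sequence of $\mathfrak{G}$: an increasing sequence $\{D_n\}_{n\in\mathbb{N}}$ of compact subsets with $|D_n|>0$ and $\lim_n|\partial^K(D_n)|/|D_n|=0$ for every compact $K\subset\mathfrak{G}$, where $\partial^K(A):=((A+K)\setminus \mathrm{Int}(A))\cup((\mathrm{Cl}(\mathfrak{G}\setminus A)-K)\cap A)$. One such sequence is fixed. *)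

(* Defs.v *)
From HB Require Import structures.
From mathcomp Require Import all_boot all_order all_algebra.
From mathcomp Require Import all_classical all_reals all_analysis.
From mathcomp Require Import finmap complex.

Set Implicit Arguments.
Unset Strict Implicit.
Unset Printing Implicit Defensive.

Import Order.TTheory GRing.Theory Num.Theory.
Import numFieldTopology.Exports numFieldNormedType.Exports.

Local Open Scope classical_set_scope.
Local Open Scope ring_scope.

(* H as a group in its own right; the topology is the one induced from G. *)
Definition subgroup (G : topologicalZmodType) (H : zmodClosed G) : Type :=
  {x : G | x \in H}.

Section Subgroup.
Variables (G : topologicalZmodType) (H : zmodClosed G).

HB.instance Definition _ := SubChoice.on (subgroup H).
HB.instance Definition _ := [SubChoice_isSubZmodule of subgroup H by <:].
HB.instance Definition _ := Topological.copy (subgroup H)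
  (initial_topology (val : subgroup H -> G)).

Let subgroup_sub_continuous :
  continuous (fun x : subgroup H * subgroup H => x.1 - x.2).
Proof.
apply/continuousP => _ [B oB <-].
have val_cont : continuous (val : subgroup H -> G) by exact: initial_continuous.
pose f (x : subgroup H * subgroup H) : G := val x.1 - val x.2.
suff /continuousP/(_ _ oB) : continuous f.
  congr open; apply/seteqP; split => x; rewrite /f /= raddfB //.
move=> x; apply: (@continuous_comp _ _ _
  (fun y : subgroup H * subgroup H => (val y.1, val y.2))
  (fun z : G * G => z.1 - z.2)); last exact: sub_continuous.
apply: cvg_pair => /=.
- by apply: (continuous_comp (@cvg_fst _ _ _ _ _) (val_cont _)).
- by apply: (continuous_comp (@cvg_snd _ _ _ _ _) (val_cont _)).
Qed.

HB.instance Definition _ :=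
  PreTopologicalNmodule_isTopologicalZmodule.Build (subgroup H)
    subgroup_sub_continuous.

End Subgroup.

(* G with its Borel sigma-algebra. Measurable types have to be pointed, which
   topological groups are not in the library: the point is 0. *)
Definition borel (G : topologicalZmodType) : Type := G.

Section Borel.
Variable G : topologicalZmodType.

HB.instance Definition _ := Choice.on (borel G).
HB.instance Definition _ := isPointed.Build (borel G) (0 : G).
HB.instance Definition _ := @isMeasurable.Build (sigma_display (@open G))
  (borel G) <<s (@open G) >> (@sigma_algebra0 _ setT (@open G))
  (@sigma_algebraC (borel G) (@open G))
  (@sigma_algebra_bigcup _ setT (@open G)).

End Borel.

Section Groups.
Variable G : topologicalZmodType.
Implicit Types A B K : set G.

Definition mink_add A B : set G := [set a + b | a in A & b in B].
Definition mink_sub A B : set G := [set a - b | a in A & b in B].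
Definition mink_opp A : set G := [set - a | a in A].
Definition translate (x : G) A : set G := [set x + a | a in A].

Definition frontier A : set G := closure A `\` interior A.

Definition sigma_compact : Prop :=
  exists2 K : nat -> set G, (forall n, compact (K n)) &
    \bigcup_n K n = [set: G].

Definition lcag : Prop :=
  [/\ hausdorff_space G, locally_compact [set: G] & sigma_compact].

Definition finitely_generated (L : set G) : Prop :=
  exists n (s : n.-tuple G), L = [set x | inIntSpan s x].

(* L/M, a coset being a subset of G. *)
Definition quotient_set (L M : set G) : set (set G) :=
  [set translate s M | s in L].

(* Regularity is required explicitly: it is not automatic, as G need not be second
   countable. *)
Definition haar_measure (R : realType) (mu : {measure set (borel G) -> \bar R})
    : Prop :=
  [/\ (0 < mu [set: G])%E,
      forall x (A : set (borel G)), measurable A ->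
        mu (translate x A) = mu A,
      forall K, compact K -> (mu K < +oo)%E,
      forall A : set (borel G), measurable A ->
        mu A = ereal_inf [set mu U | U in [set U : set G | open U /\ A `<=` U]] &
      forall U : set G, open U ->
        mu U = ereal_sup [set mu K | K in [set K | compact K /\ K `<=` U]]].

Definition vH_boundary K A : set G :=
  (mink_add A K `\` interior A) `|` (mink_sub (closure (~` A)) K `&` A).

Definition van_Hove (R : realType) (mu : {measure set (borel G) -> \bar R})
    (D : nat -> set G) : Prop :=
  [/\ {homo D : m n / (m <= n)%N >-> m `<=` n},
      forall n, compact (D n),
      forall n, (0 < mu (D n))%E &
      forall K, compact K ->
        (mu (vH_boundary K (D n)) / mu (D n))%E @[n --> \oo] --> 0%E].

(* l_A(x;s) and l_A(x) range over the naturals and +oo, embedded in \bar R, where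
   the maximum of a nonempty set of such values is its supremum. *)
Definition ell_at (R : realType) A (x s : G) : \bar R :=
  if x == 0 then 0%E else
  ereal_sup [set k%:R%:E | k in
    [set k : nat | forall n, (n <= k)%N -> A (s - x *+ n)]].

Definition ell (R : realType) A (x : G) : \bar R :=
  ereal_sup [set ell_at R A x s | s in A].

Definition finitely_periodic (R : realType) A : Prop :=
  forall x, mink_sub A A x -> (ell R A x < +oo)%E.

End Groups.

Section CutAndProject.
Variables G Gint : topologicalZmodType.

(* The first condition says that L is discrete in its relative topology. *)
Definition lattice (L : zmodClosed (G * Gint)%type) : Prop :=
  isolated [set` L] = [set` L] /\
  compact [set: quotient_topology (Quotient.quot L)].

Definition cut_and_project (L : zmodClosed (G * Gint)%type) : Prop :=
  [/\ lcag G, lcag Gint, lattice L,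
      {in L &, injective (@fst G Gint)} &
      dense [set x.2 | x in [set` L]]].

Definition proj_lattice (L : zmodClosed (G * Gint)%type) : set G :=
  [set x.1 | x in [set` L]].

(* The y with (s, y) in L, unique when s is in proj_lattice L; 0 by default. *)
Definition star (L : zmodClosed (G * Gint)%type) (s : G) : Gint :=
  xget 0 [set y | (s, y) \in L].

Definition cp_set (L : zmodClosed (G * Gint)%type) (W : set Gint) : set G :=
  [set x.1 | x in [set x | x \in L /\ W x.2]].

Definition window (W : set Gint) : Prop :=
  [/\ W !=set0, measurable (W : set (borel Gint)) & precompact W].

End CutAndProject.

Definition cp_subscheme (G Gint : topologicalZmodType)
    (L : zmodClosed (G * Gint)%type) (H : zmodClosed Gint)
    (M : zmodClosed (G * subgroup H)%type) : Prop :=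
  cut_and_project M /\ (forall x, x \in M -> (x.1, val x.2) \in L).

Section Probability.
Variables (R : realType) (d : measure_display) (T : measurableType d).
Variable P : probability T R.
Variable I : choiceType.
Implicit Types (X : I -> T -> borel (R[i]^o)) (S : set I).

Definition sigma_algebra_of X S : set (set T) :=
  <<s \bigcup_(s in S) preimage_set_system setT (X s) measurable >>.

(* The random vectors (X_s)_{s in A} and (X_s)_{s in B} are independent when the
   sigma-algebras they generate are. *)
Definition independent_vectors X (A B : set I) : Prop :=
  forall E F : set T, sigma_algebra_of X A E -> sigma_algebra_of X B F ->
    P (E `&` F) = (P E * P F)%E.

Definition independent_family X S : Prop :=
  forall (J : {fset I}) (B : I -> set (borel (R[i]^o))),
    [set` J] `<=` S -> (forall i, measurable (B i)) ->
    P (\bigcap_(i in [set` J]) X i @^-1` B i) =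
    (\prod_(i <- J) P (X i @^-1` B i))%E.

(* The values of X outside of S are irrelevant. *)
Definition random_field X S : Prop :=
  forall s, S s -> measurable_fun setT (X s).

End Probability.

Section RandomizedModelSet.
Variables (R : realType) (d : measure_display) (T : measurableType d).
Variables (P : probability T R) (G : topologicalZmodType).

Definition d_set (X : G -> T -> R[i]) (S D : set G) : Prop :=
  [/\ D = mink_opp D, D `<=` mink_sub S S &
      forall A B : set G, finite_set A -> finite_set B ->
        A `<=` S -> B `<=` S -> mink_sub A B `&` D = set0 ->
        independent_vectors P X A B].

Definition finitely_randomized (X : G -> T -> R[i]) (S : set G) : Prop :=
  random_field X S /\ exists2 D : set G, finite_set D & d_set X S D.

End RandomizedModelSet.

(* Main.v *)
Require Import Defs.
From HB Require Import structures.
From mathcomp Require Import all_boot all_order all_algebra.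
From mathcomp Require Import all_classical all_reals all_analysis.
From mathcomp Require Import finmap complex measurable_realfun ring lra.

Set Implicit Arguments.
Unset Strict Implicit.
Unset Printing Implicit Defensive.

Import Order.TTheory GRing.Theory Num.Theory.
Import numFieldTopology.Exports numFieldNormedType.Exports.

Local Open Scope classical_set_scope.
Local Open Scope ring_scope.

(* Finitely generated abelian groups are residually finite, so L has a
   finite-index subgroup M that contains no nonzero difference of elements of
   D u {0}, D being the finite d-set. The internal space of the subscheme is the
   closure of the star image of M. Let x = g - r, and cut Lambda along each coset
   of M according to the exact number k of steps -x that stay in Lambda. Two
   points s, t of the same piece have s - t in M, hence s - t is not in D; and
   s - t + g in D would force s - t + g = r, since r + M meets D at most once and r
   is chosen there when possible. Then s = t - x, which is impossible because
   s and t have the same exact run length.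

   Densities: with N_n(A) the number of lattice points over D_n with star image in
   A, the count for a translate x + D_n equals, up to o(|D_n|), that of D_n, uniformly
   in x: cocompactness reduces the translate to a bounded one of D_n and of A,
   density of the star image of M reduces the latter to a small one, and a small
   shift of A only affects points near its frontier, which have density zero by a
   packing argument. Computing in two ways the sum over p of the measures of the
   intersections of D_n and p + D_m then shows that N_n(A) / |D_n| is a Cauchy sequence. *)

(** * Topological groups *)

(** Were there no finite subcover, the parts of [K] left uncovered by finite subfamilies would form
    a proper filter base; a cluster point of it lies in some [f i], a neighbourhood that one of
    these parts avoids. *)
Lemma finite_cover (T : topologicalType) (I : choiceType) (D : set I)
    (f : I -> set T) (K : set T) :
  compact K -> (forall x, K x -> exists2 i, D i & nbhs x (f i)) ->
  exists2 s : seq I, (forall i, i \in s -> D i) &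
    forall x, K x -> exists2 i, i \in s & f i x.
Proof.
move=> cK cov; apply: contrapT => nofin.
pose ok := [set s : seq I | forall i, i \in s -> D i].
pose B := fun s : seq I => [set x | K x /\ forall i, i \in s -> ~ f i x].
have FF : ProperFilter (filter_from ok B).
  apply: filter_from_proper.
    apply: filter_from_filter; first by exists [::].
    move=> s t oks okt; exists (s ++ t).
      by move=> i; rewrite mem_cat => /orP[/oks|/okt].
    move=> x [Kx nx]; split; split => // i ist; apply: nx;
      by rewrite mem_cat ist ?orbT.
  move=> s oks; apply: contrapT => /forallNP nB; apply: nofin.
  exists s => // x Kx; apply: contrapT => /forall2NP nx.
  by apply: (nB x); split => // i si; have [|] := nx i.
have [|x [Kx clx]] := cK (filter_from ok B) FF; first by exists [::] => // x [].
have [i Di fi] := cov x Kx.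
have Bi : filter_from ok B (B [:: i]).
  by exists [:: i] => // j; rewrite inE => /eqP->.
by have [y [[_ /(_ i (mem_head _ _))]]] := clx _ _ Bi fi.
Qed.

Section TopologicalGroup.
Variable G : topologicalZmodType.
Implicit Types (A B F K O U V : set G) (x y : G).

Lemma nbhs_subl x U : nbhs 0 U -> nbhs x [set y | U (y - x)].
Proof.
move=> U0; have : (fun y : G => y - x) @ x --> (x - x).
  apply: (@continuous_comp _ _ _ (fun y => (y, x)) (fun z : G * G => z.1 - z.2)).
    by apply: cvg_pair; [exact: cvg_id|exact: cvg_cst].
  exact: sub_continuous.
by rewrite subrr; apply.
Qed.

Lemma nbhs0_add x U : nbhs x U -> nbhs 0 [set y | U (x + y)].
Proof.
move=> Ux; have : (fun y : G => x + y) @ 0 --> (x + 0).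
  apply: (@continuous_comp _ _ _ (fun y => (x, y)) (fun z : G * G => z.1 + z.2)).
    by apply: cvg_pair; [exact: cvg_cst|exact: cvg_id].
  exact: add_continuous.
by rewrite addr0; apply.
Qed.

Lemma nbhs0_opp U : nbhs 0 U -> nbhs 0 [set y | U (- y)].
Proof.
by move=> U0; have := @opp_continuous G 0; rewrite /continuous_at oppr0; apply.
Qed.

Lemma nbhs0_half U : nbhs 0 U ->
  exists V, [/\ nbhs 0 V, forall u, V u -> V (- u) &
    forall u v, V u -> V v -> U (u + v)].
Proof.
move=> U0; have := @add_continuous G (0, 0); rewrite /continuous_at /= addr0.
move=> /(_ _ U0) [[A B] /= [A0 B0] AB].
pose V := A `&` B.
have V0 : nbhs 0 V by exact: filterI.
exists (V `&` [set y | V (- y)]); split.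
- by apply: filterI => //; exact: nbhs0_opp.
- by move=> u [] ? ?; split => //=; rewrite opprK.
- by move=> u v [[Au Bu] _] [[Av Bv] _]; exact: (AB (u, v)).
Qed.

(** Tube argument: addition is continuous at each [(x, 0)], and compactness of [K] makes one
    neighbourhood of [0] serve all its points. *)
Lemma compact_nbhs_add K O : compact K -> open O -> K `<=` O ->
  \forall u \near (0 : G), forall k, K k -> O (k + u).
Proof.
move=> /compact_near_coveringP cK oO KO.
apply: (cK G (nbhs (0 : G)) (fun u k => O (k + u))) => x Kx.
have := @add_continuous G (x, 0); rewrite /continuous_at /= addr0.
apply; exact/open_nbhs_nbhs/(conj oO)/KO.
Qed.

Lemma compact_mink_add A B : compact A -> compact B -> compact (mink_add A B).
Proof.
move=> cA cB.
have -> : mink_add A B = (fun z : G * G => z.1 + z.2) @` (A `*` B).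
  apply/seteqP; split => [_ [a Aa [b Bb <-]]|_ [[a b] /= [Aa Bb] <-]].
    by exists (a, b).
  by exists a => //; exists b.
apply: continuous_compact; last exact: compact_setX.
by apply: continuous_subspaceT => z; exact: add_continuous.
Qed.

Lemma compact_mink_opp A : compact A -> compact (mink_opp A).
Proof.
move=> cA; apply: continuous_compact => //.
by apply: continuous_subspaceT => z; exact: opp_continuous.
Qed.

Lemma mink_opp_preimage A : mink_opp A = -%R @^-1` A.
Proof.
apply/seteqP; split => [_ [a Aa <-]|x /= Ax]; rewrite /preimage/= ?opprK//.
by exists (- x) => //; rewrite opprK.
Qed.

Lemma translate_preimage x A : translate x A = (fun y => y - x) @^-1` A.
Proof.
apply/seteqP; split => [_ [a Aa <-]|y /= Ay]; rewrite /preimage/=.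
  by rewrite addrAC subrr add0r.
by exists (y - x) => //; rewrite addrC subrK.
Qed.

Lemma subr_continuous x : continuous (fun y : G => y - x).
Proof.
move=> y; apply: (@continuous_comp _ _ _ (fun y => (y, x)) (fun z : G * G => z.1 - z.2)).
  by apply: cvg_pair; [exact: cvg_id|exact: cvg_cst].
exact: sub_continuous.
Qed.

Lemma open_translate x A : open A -> open (translate x A).
Proof.
by rewrite translate_preimage => oA; apply: open_comp => // ? _; exact: subr_continuous.
Qed.

Lemma closed_translate x A : closed A -> closed (translate x A).
Proof.
by rewrite translate_preimage => oA; apply: closed_comp => // ? _; exact: subr_continuous.
Qed.

Lemma open_mink_opp A : open A -> open (mink_opp A).
Proof.
by rewrite mink_opp_preimage => oA; apply: open_comp => // ? _; exact: opp_continuous.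
Qed.

Lemma compact_translate x A : compact A -> compact (translate x A).
Proof.
move=> cA; apply: continuous_compact => //.
apply: continuous_subspaceT => z.
by have := @subr_continuous (- x) z; under eq_fun do rewrite opprK addrC.
Qed.

(** If [x] is not in A - K, the compact set x + K misses the closed set [A], and so do its small
    translates. *)
Lemma closed_mink_sub A K : closed A -> compact K -> closed (mink_sub A K).
Proof.
move=> cA cK; rewrite -[mink_sub A K]setCK; apply: open_closedC.
rewrite openE => x nx.
have sub : translate x K `<=` ~` A.
  move=> _ [k Kk <-] Ak; apply: nx; exists (x + k) => //; exists k => //.
  by rewrite addrK.
have near0 := compact_nbhs_add (@compact_translate x K cK) (closed_openC cA) sub.
apply: filterS (nbhs_subl x near0) => y /= yx [a Aa [k Kk eqy]].
apply: (yx (x + k)); first by exists k.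
suff -> : x + k + (y - x) = a by [].
by rewrite -eqy addrC addrA !subrK.
Qed.

Lemma closure_near0 A x : closure A x <->
  (forall U, nbhs 0 U -> exists2 a, A a & U (x - a)).
Proof.
split=> [clA U U0|h V Vx].
  have [a [Aa Ua]] := clA _ (nbhs_subl x (nbhs0_opp U0)).
  by exists a => //; rewrite /= opprB in Ua.
have [a Aa /= Va] := h _ (nbhs0_opp (nbhs0_add Vx)).
by exists a; split => //; rewrite opprB addrC subrK in Va.
Qed.

Lemma frontierI A B : frontier (A `&` B) `<=` frontier A `|` frontier B.
Proof.
move=> x [cl nint]; have [iA|nA] := pselect (interior A x); last first.
  by left; split => //; case: (closureI cl).
right; split; first by have [] := closureI cl.
by move=> iB; apply: nint; rewrite interiorI.
Qed.

Lemma frontierC A : frontier (~` A) = frontier A.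
Proof.
by rewrite /frontier closure_setC interiorC setDE setCK setIC setDE.
Qed.

Lemma frontierE A x : frontier A x <-> forall U, nbhs x U ->
  (exists2 a, A a & U a) /\ (exists2 a, ~ A a & U a).
Proof.
rewrite /frontier setDE -closure_setC; split=> [[cA cCA] U Ux|h].
  by split; [have [y []] := cA _ Ux|have [y []] := cCA _ Ux]; exists y.
by split => U /h[[a ? ?] [b ? ?]]; [exists a|exists b].
Qed.

Lemma frontier_translate x A : frontier (translate x A) = translate x (frontier A).
Proof.
apply/seteqP; split => [y|_ [y fy <-]].
  rewrite [translate x (frontier A)]translate_preimage => /frontierE fy.
  apply/frontierE => U Uyx.
  have := fy [set z | U (z - x)] (subr_continuous Uyx).
  rewrite translate_preimage => -[[a ? ?] [b ? ?]].
  by split; [exists (a - x)|exists (b - x)].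
apply/frontierE => U Uy.
have : nbhs y [set z | U (x + z)].
  rewrite (_ : [set z | _] = (fun z => z - - x) @^-1` U).
    by apply: subr_continuous; rewrite opprK addrC.
  by apply/funext => z; rewrite /preimage /= opprK addrC.
move/frontierE : fy => /[apply] -[[a ? ?] [b ? ?]].
split; [exists (x + a) => //; by exists a|exists (x + b) => //].
by rewrite translate_preimage /preimage /= addrAC subrr add0r.
Qed.

Lemma frontier_opp A : frontier (mink_opp A) = mink_opp (frontier A).
Proof.
have sub B : frontier (mink_opp B) `<=` mink_opp (frontier B).
  move=> y /frontierE fy; rewrite mink_opp_preimage; apply/frontierE => U Uy.
  have := fy [set z | U (- z)] (@opp_continuous G y _ Uy).
  rewrite mink_opp_preimage => -[[a ? ?] [b ? ?]].
  by split; [exists (- a)|exists (- b)].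
apply/seteqP; split => // _ [y fy <-].
have := sub (mink_opp A) y; rewrite !mink_opp_preimage /preimage /=.
rewrite (_ : [set t | A (- - t)] = A) => [/(_ fy)//|].
by apply/funext => t; rewrite /mkset opprK.
Qed.

Lemma compact_nbhs0 : lcag G -> exists2 K, compact K & nbhs (0 : G) K.
Proof.
move=> [hG lG _]; have [K Kn [cK _]] := lG 0 I.
exists K => //; move: Kn; rewrite /within /=.
by apply: filterS => x; apply.
Qed.

End TopologicalGroup.

(** * Residual finiteness of finitely generated abelian groups *)

Section ResiduallyFinite.
Variable V : zmodType.
Implicit Types (A B L N : set V) (a x y : V) (s t : seq V).

Definition is_subgroup N := N 0 /\ forall x y, N x -> N y -> N (x - y).

Lemma is_subgroupN N x : is_subgroup N -> N x -> N (- x).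
Proof. by move=> [N0 NB] Nx; rewrite -sub0r; exact: NB. Qed.

Lemma is_subgroupD N x y : is_subgroup N -> N x -> N y -> N (x + y).
Proof. by move=> sN Nx Ny; rewrite -[y]opprK; apply: sN.2 => //; exact: is_subgroupN. Qed.

Lemma is_subgroupMz N x (k : int) : is_subgroup N -> N x -> N (x *~ k).
Proof.
move=> sN Nx; have natN n : N (x *+ n).
  by elim: n => [|n IH]; [rewrite mulr0n; exact: sN.1|rewrite mulrS; exact: is_subgroupD].
by case: k => n; [exact: natN|rewrite NegzE mulrNz; apply: is_subgroupN => //; exact: natN].
Qed.

(** Finite index as a list of representatives, which may repeat cosets and lie outside [A];
    [index_reps_in] moves them into [A]. *)
Definition index_reps A N s := forall x, A x -> exists2 r, r \in s & N (x - r).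

Lemma index_reps_in A N s : is_subgroup N -> index_reps A N s ->
  exists2 t, (forall r, r \in t -> A r) & index_reps A N t.
Proof.
move=> sN sA.
pose f r := if pselect (exists2 x, A x & N (x - r)) is left h then sval (cid2 h)
            else 0.
exists [seq f r | r <- s & `[< exists2 x, A x & N (x - r)>]].
  move=> y /mapP[r]; rewrite mem_filter => /andP[/asboolP h _] ->.
  by rewrite /f; case: pselect => // h'; case: cid2.
move=> x Ax; have [r rs Nxr] := sA x Ax.
have h : exists2 x, A x & N (x - r) by exists x.
exists (f r); first by apply: map_f; rewrite mem_filter rs andbT; exact/asboolP.
rewrite /f; case: pselect => // h'; case: cid2 => z /= Az Nzr.
by have := sN.2 _ _ Nxr Nzr; rewrite opprB addrA subrK.
Qed.

(** A nonempty intersection with [A] of a coset of [N] and one of [N'] is covered by any of its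
    points, so one point per pair of representatives suffices. Pairs with empty intersection get the
    harmless default [0]. *)
Lemma index_repsI A N N' s t : is_subgroup N -> is_subgroup N' ->
  index_reps A N s -> index_reps A N' t -> exists u, index_reps A (N `&` N') u.
Proof.
move=> sN sN' As At.
pose P z (rr : V * V) := A z /\ N (z - rr.1) /\ N' (z - rr.2).
pose f rr := xget 0 [set z | P z rr].
exists [seq f rr | rr <- [seq (r, r') | r <- s, r' <- t]] => x Ax.
have [r rs Nxr] := As x Ax; have [r' rt Nxr'] := At x Ax.
have [Af [Nf Nf']] : [set z | P z (r, r')] (f (r, r')) by apply: xgetPex; exists x.
exists (f (r, r')); first by apply: map_f; apply/allpairsP; exists (r, r').
split.
  by have := sN.2 _ _ Nxr Nf; rewrite opprB addrA subrK.
by have := sN'.2 _ _ Nxr' Nf'; rewrite opprB addrA subrK.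
Qed.

Fixpoint zspan s : set V :=
  if s is x :: s' then [set x *~ k + y | k in [set: int] & y in zspan s']
  else [set 0].

Lemma zspan_subgroup s : is_subgroup (zspan s).
Proof.
elim: s => [|x s [IH0 IHB]]; first by split => // ? ? -> ->; rewrite subr0.
split; first by exists 0 => //; exists 0 => //; rewrite mulr0z addr0.
move=> _ _ [k _ [y sy <-]] [l _ [z sz <-]].
by exists (k - l) => //; exists (y - z); [exact: IHB|rewrite mulrzBr opprD addrACA].
Qed.

(* Induction on the generators: the first generator x either has a nonzero multiple
   in the span B of the others, so that B has finite index, or splits off. *)
Lemma zspan_avoid s a : a != 0 -> exists N,
  [/\ is_subgroup N, N `<=` zspan s, exists t, index_reps (zspan s) N t & ~ N a].
Proof.
elim: s => [|x s IH] a0.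
  exists [set 0]; split => //.
  - by split => // ? ? -> ->; rewrite subr0.
  - by exists [:: 0] => _ ->; exists 0; rewrite ?mem_head// subr0.
  - by apply/eqP.
have sB := zspan_subgroup s; set B := zspan s in IH sB *.
have BA : B `<=` zspan (x :: s).
  by move=> y By; exists 0 => //; exists y => //; rewrite mulr0z add0r.
have [N [sN NB [t Nt] Na]] := IH a0.
have divk (k : int) (l : int) : k != 0 -> exists2 j, j \in iota 0 `|k|%N &
    exists q, l = k * q + j%:Z.
  move=> k0; exists `|(l %% k)%Z|%N.
    by rewrite mem_iota /= add0n -ltz_nat gez0_abs ?modz_ge0// ltz_mod.
  exists (l %/ k)%Z; rewrite gez0_abs ?modz_ge0//.
  by rewrite {1}(divz_eq l k) mulrC.
have [[k k0 Bk]|nk] := pselect (exists2 k : int, k != 0 & B (x *~ k)).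
  exists N; split => //; first by move=> y /NB/BA.
  exists [seq x *+ j + r | j <- iota 0 `|k|%N, r <- t].
  move=> _ [l _ [y By <-]]; have [j jk [q ->]] := divk k l k0.
  have : B (x *~ (k * q) + y).
    by apply: is_subgroupD => //; rewrite mulrzA; exact: is_subgroupMz.
  move=> /Nt[r rt Nr]; exists (x *+ j + r); first by apply/allpairsP; exists (j, r).
  suff -> : x *~ (k * q + j%:Z) + y - (x *+ j + r) = x *~ (k * q) + y - r by [].
  by rewrite mulrzDr opprD addrACA -[x *~ j%:Z]/(x *+ j) addrK addrA.
have {}nk k : B (x *~ k) -> k = 0.
  by move=> Bk; apply/eqP; apply: contrapT => /negP k0; apply: nk; exists k.
have [[k k0 [y By ay]]|ka] :=
    pselect (exists2 k : int, k != 0 & exists2 y, B y & a = x *~ k + y).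
  (* No nonzero multiple of [x] is in [B], so membership of [a] would give k = 2 k j, against
     parity; the index is finite because [2 * k] is nonzero. *)
  exists [set x *~ (2 * k * j) + z | j in [set: int] & z in B]; split.
  - split; first by exists 0 => //; exists 0; [exact: sB.1|rewrite mulr0 mulr0z addr0].
    move=> _ _ [j _ [z Bz <-]] [l _ [w Bw <-]]; exists (j - l) => //.
    by exists (z - w); [exact: sB.2|rewrite mulrBr mulrzBr opprD addrACA].
  - by move=> _ [j _ [z Bz <-]]; exists (2 * k * j) => //; exists z.
  - have k20 : 2 * k != 0 by rewrite mulf_neq0.
    exists [seq x *+ j | j <- iota 0 `|(2 * k)%R|%N].
    move=> _ [l _ [z Bz <-]]; have [j jk [q ->]] := divk _ l k20.
    exists (x *+ j); first exact: map_f.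
    exists q => //; exists z => //.
    by rewrite mulrzDr -[x *~ j%:Z]/(x *+ j) addrAC addrK.
  - move=> [j _ [z Bz eqa]].
    have /nk/eqP : B (x *~ (k * (1 - 2 * j))).
      suff -> : x *~ (k * (1 - 2 * j)) = z - y by exact: sB.2.
      rewrite mulrBr mulr1 mulrCA mulrA mulrzBr; apply/eqP.
      by rewrite subr_eq (addrC (z - y)) addrA eq_sym subr_eq eqa ay.
    rewrite mulf_eq0 (negbTE k0) /= subr_eq0 => /eqP h.
    by have := congr1 (fun i => (i %% 2)%Z) h; rewrite modzMr.
(* No expression of [a] over [x] and [B] has a nonzero coefficient at [x], so adding all multiples
   of [x] to [N] still leaves [a] out. *)
exists [set x *~ j + z | j in [set: int] & z in N]; split.
- split; first by exists 0 => //; exists 0; [exact: sN.1|rewrite mulr0z addr0].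
  move=> _ _ [j _ [z Nz <-]] [l _ [w Nw <-]]; exists (j - l) => //.
  by exists (z - w); [exact: sN.2|rewrite mulrzBr opprD addrACA].
- by move=> _ [j _ [z Nz <-]]; exists j => //; exists z => //; exact: NB.
- exists t => _ [j _ [z Bz <-]]; have [r rt Nr] := Nt z Bz.
  by exists r => //; exists j => //; exists (z - r) => //; rewrite addrA.
move=> [j _ [z Nz eqa]]; have [j0|j0] := eqVneq j 0.
  by apply: Na; rewrite -eqa j0 mulr0z add0r.
by apply: ka; exists j => //; exists z => //; exact: NB.
Qed.

Lemma zspan_avoid_seq s (l : seq V) : 0 \notin l -> exists N,
  [/\ is_subgroup N, exists t, index_reps (zspan s) N t &
      forall a, a \in l -> ~ N a].
Proof.
elim: l => [_|a l IH].
  exists (zspan s); split => //; first exact: zspan_subgroup.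
  by exists [:: 0] => x sx; exists 0; rewrite ?mem_head// subr0.
rewrite inE negb_or eq_sym => /andP[a0 /IH[N [sN [t Nt] Nl]]].
have [N' [sN' _ [t' Nt'] Na]] := zspan_avoid s a0.
exists (N' `&` N); split; last 2 first.
- exact: index_repsI Nt' Nt.
- by move=> b; rewrite inE => /orP[/eqP-> []//|/Nl nb []].
split; first by split; [exact: sN'.1|exact: sN.1].
by move=> x y [? ?] [? ?]; split; [exact: sN'.2|exact: sN.2].
Qed.

Lemma inIntSpan_zspan n (s : n.-tuple V) x : inIntSpan s x -> zspan s x.
Proof.
move=> [k ->]; apply: big_ind => [|y z sy sz|i _].
- by have [] := zspan_subgroup s.
- exact: is_subgroupD (zspan_subgroup s) sy sz.
apply: is_subgroupMz; first exact: zspan_subgroup.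
have : s`_i \in tval s by rewrite mem_nth ?size_tuple.
elim: (tval s) (s`_i) => // y t IH z; rewrite inE => /orP[/eqP->|/IH tz].
  exists 1 => //; exists 0; last by rewrite addr0.
  by have [] := zspan_subgroup t.
by exists 0 => //; exists z => //; rewrite mulr0z add0r.
Qed.

End ResiduallyFinite.

Lemma finite_index_avoid (G : topologicalZmodType) (L : set G) (l : seq G) :
  is_subgroup L -> finitely_generated L -> 0 \notin l ->
  exists N t, [/\ is_subgroup N, N `<=` L, forall r, r \in t -> L r,
    index_reps L N t & forall a, a \in l -> ~ N a].
Proof.
move=> sL [n [s eqL]] l0; have [N [sN [t Nt] Nl]] := zspan_avoid_seq s l0.
have sNL : is_subgroup (N `&` L).
  split; first by split; [exact: sN.1|exact: sL.1].
  by move=> x y [? ?] [? ?]; split; [exact: sN.2|exact: sL.2].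
have LNt : index_reps L N t.
  by move=> x; rewrite eqL => /inIntSpan_zspan/Nt.
have [t' t'L Nt'] := index_reps_in sN LNt.
exists (N `&` L), t'; split => [//|x []//|//||].
- move=> x Lx; have [r rt' Nr] := Nt' x Lx; exists r => //; split => //.
  exact: sL.2 _ _ Lx (t'L _ rt').
- by move=> a /Nl na [].
Qed.

(** * Counting and multiplicities *)

Section Cardinal.
Variables (R : realType) (T : choiceType).
Implicit Types A B C : set T.

(** Meaningful for finite sets only: [fset_set] sends an infinite set to the empty one. *)
Definition nb A : R := (#|` fset_set A|)%:R.

Lemma nb_ge0 A : 0 <= nb A.
Proof. exact: ler0n. Qed.

Lemma nb_le A B : finite_set B -> A `<=` B -> nb A <= nb B.
Proof.
move=> fB AB; rewrite ler_nat fsubset_leq_card// -fset_set_sub//.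
exact: sub_finite_set fB.
Qed.

Lemma nb_leD A B C : finite_set B -> finite_set C -> A `<=` B `|` C ->
  nb A <= nb B + nb C.
Proof.
move=> fB fC ABC; rewrite -natrD ler_nat.
apply: leq_trans (leq_card_fsetU (fset_set B) (fset_set C)).1.
rewrite -fset_setU// fsubset_leq_card// -fset_set_sub//; last first.
  by rewrite finite_setU.
by apply: sub_finite_set ABC _; rewrite finite_setU.
Qed.

Lemma nb_sum A B : finite_set B -> A `<=` B ->
  nb A = \sum_(p <- fset_set B) (p \in A)%:R.
Proof.
move=> fB AB; have fA : finite_set A by exact: sub_finite_set fB.
rewrite /nb -natr_sum; congr (_%:R).
rewrite (eq_bigr (fun p => if p \in A then 1%N else 0%N)); last first.
  by move=> p _; case: (p \in A).
rewrite -big_mkcond/= sum1_count -size_filter; apply: perm_size.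
apply: uniq_perm => [||p]; rewrite ?filter_uniq ?fset_uniq//.
rewrite mem_filter !in_fset_set//; apply/idP/andP => [Ap|[]//].
by split=> //; apply/mem_set/AB/set_mem.
Qed.

End Cardinal.

Lemma nb_image (R : realType) (T T' : choiceType) (f : T -> T') (A : set T) :
  finite_set A -> {in A &, injective f} -> nb R (f @` A) = nb R A.
Proof.
move=> fA injf; rewrite /nb fset_set_image// card_in_imfset//=.
by move=> x y; rewrite !in_fset_set//; exact: injf.
Qed.

(** An infinite set has finite subsets of any size, so a common bound on the finite subsets yields
    finiteness and the count at once. *)
Lemma finite_set_bounded (R : realType) (T : choiceType) (A : set T) (c : R) :
  (forall F : {fset T}, [set` F] `<=` A -> (#|` F|)%:R <= c) ->
  finite_set A /\ nb R A <= c.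
Proof.
move=> h; have fA : finite_set A.
  apply: contrapT => /(infinite_set_fset (Num.truncn c).+1)[F /h Fc cF].
  have := le_lt_trans Fc (truncnS_gt c).
  by rewrite ltr_nat ltnNge cF.
by split => //; apply: h; rewrite fset_setK.
Qed.

Section Multiplicity.
Variables (R : realType) (d : measure_display) (T : measurableType d).
Variables (mu : {measure set T -> \bar R}) (I : choiceType) (s : seq I).
Variables (E : I -> set T) (Z : set T).
Hypotheses (mE : forall i, measurable (E i)) (mZ : measurable Z).

(** Exchanging sum and integral gives the integral over [Z] of the multiplicity with which the [E i]
    cover a point. Pointwise bounds on it then yield the next two estimates, which serve the packing
    argument and the double counting. *)
Lemma sum_measure_integral :
  (\sum_(i <- s) mu (E i `&` Z) =
   \int[mu]_(x in Z) (\sum_(i <- s) \1_(E i) x)%:E)%E.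
Proof.
under eq_integral do rewrite -sumEFin.
rewrite ge0_integral_sum//.
- by apply: eq_bigr => i _; rewrite integral_indic.
- move=> i; exact/measurable_EFinP/measurable_indic.
Qed.

Let mf : measurable_fun Z (fun x => (\sum_(i <- s) \1_(E i) x)%:E : \bar R).
Proof.
apply/measurable_EFinP; apply: measurable_sum => i; exact: measurable_indic.
Qed.

Lemma sum_measure_le (b : R) : 0 <= b ->
  (forall x, Z x -> \sum_(i <- s) \1_(E i) x <= b) ->
  (\sum_(i <- s) mu (E i `&` Z) <= b%:E * mu Z)%E.
Proof.
move=> b0 h; rewrite sum_measure_integral -integral_cst//.
apply: ge0_le_integral => //= x Zx; rewrite lee_fin ?sumr_ge0 ?h//.
Qed.

Lemma sum_measure_ge (b : R) : 0 <= b ->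
  (forall x, Z x -> b <= \sum_(i <- s) \1_(E i) x) ->
  (b%:E * mu Z <= \sum_(i <- s) mu (E i `&` Z))%E.
Proof.
move=> b0 h; rewrite sum_measure_integral -integral_cst//.
by apply: ge0_le_integral => //= x Zx; rewrite lee_fin ?h.
Qed.

End Multiplicity.

Lemma measure_mono (R : realType) (d : measure_display) (T : measurableType d)
    (mu : {measure set T -> \bar R}) (A B : set T) :
  measurable A -> measurable B -> A `<=` B -> (mu A <= mu B)%E.
Proof. by move=> mA mB; apply: le_measure; apply: mem_set. Qed.

(** Induction on the cover: if the first set meets [K] in a null set, removing it from [K] leaves
    the measure unchanged. *)
Lemma measure_cover_gt0 (R : realType) (d : measure_display)
    (T : measurableType d) (mu : {measure set T -> \bar R}) (I : choiceType)
    (s : seq I) (E : I -> set T) (K : set T) :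
  (forall i, measurable (E i)) -> measurable K ->
  (forall x, K x -> exists2 i, i \in s & E i x) -> (0 < mu K)%E ->
  exists2 i, i \in s & (0 < mu (K `&` E i))%E.
Proof.
move=> mE; elim: s K => [|i s IH] K mK cov K0.
  suff K00 : K = set0 by rewrite K00 measure0 ltxx in K0.
  by rewrite -subset0 => x /cov[].
have [KE|KE] := ltP 0%E (mu (K `&` E i)); first by exists i; rewrite ?mem_head.
have [|||j js Kj] := IH (K `\` E i); first exact: measurableD.
- move=> x [/cov[j]]; rewrite inE => /orP[/eqP->//|js Ej _]; by exists j.
- apply: lt_le_trans K0 _.
  have mKE : measurable (K `&` E i) by exact: measurableI.
  have -> : mu (K `\` E i) = mu (K `\` E i) + mu (K `&` E i).
    by move: KE; rewrite measure_le0 => /eqP->; rewrite adde0.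
  by rewrite -measureDI.
exists j; first by rewrite inE js orbT.
apply: lt_le_trans Kj _; apply: measure_mono; last by move=> x [[]].
- by apply: measurableI => //; exact: measurableD.
- exact: measurableI.
Qed.

(** * Bounded sets, boundaries and Haar measures *)

Section Bounded.
Variable G : topologicalZmodType.
Implicit Types (A B C K : set G) (a : G).

Definition bdd A := exists2 K, compact K & A `<=` K.

Lemma bdd_compact K : compact K -> bdd K. Proof. by exists K. Qed.

Lemma bddS A B : A `<=` B -> bdd B -> bdd A.
Proof. by move=> AB [K cK BK]; exists K => // x /AB/BK. Qed.

Lemma bddU A B : bdd A -> bdd B -> bdd (A `|` B).
Proof.
move=> [K cK AK] [K' cK' BK']; exists (K `|` K'); first exact: compactU.
exact: setUSS.
Qed.

Lemma bdd_add A B : bdd A -> bdd B -> bdd (mink_add A B).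
Proof.
move=> [K cK AK] [K' cK' BK']; exists (mink_add K K').
  exact: compact_mink_add.
by move=> _ [a /AK Ka [b /BK' Kb <-]]; exists a => //; exists b.
Qed.

Lemma bdd_opp A : bdd A -> bdd (mink_opp A).
Proof.
move=> [K cK AK]; exists (mink_opp K); first exact: compact_mink_opp.
by move=> _ [a /AK Ka <-]; exists a.
Qed.

(** The translate A - a, written as a preimage so that shifts compose by mere associativity. *)
Definition shift a A : set G := [set x | A (x + a)].

Lemma bdd_shifts A B : bdd A -> bdd B ->
  bdd [set x | exists2 b, B b & A (x + b)].
Proof.
move=> bA bB; apply: bddS (bdd_add bA (bdd_opp bB)).
move=> x [b Bb Ab]; exists (x + b) => //; exists (- b); last by rewrite addrK.
by exists b.
Qed.

Lemma bdd_shift a A : bdd A -> bdd (shift a A).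
Proof.
move=> bA; have b1 : bdd [set a] by apply/bdd_compact/compact_set1.
by apply: bddS (bdd_shifts bA b1) => x Ax; exists a.
Qed.

Lemma shift_shift a b A : shift a (shift b A) = shift (a + b) A.
Proof. by apply/funext => x; rewrite /shift /= addrA. Qed.

Lemma shift0 A : shift 0 A = A.
Proof. by apply/funext => x; rewrite /shift /= addr0. Qed.

(* Contained in [vH_boundary (K `|` mink_opp K) A], and easier to shift and enlarge. *)
Definition straddle K A : set G :=
  [set z | (exists2 k, K k & A (z + k)) /\ (exists2 k, K k & ~ A (z + k))].

Lemma bdd_straddle K A : bdd K -> bdd A -> bdd (straddle K A).
Proof. by move=> bK bA; apply: bddS (bdd_shifts bA bK) => z []. Qed.

Lemma sub_straddle K K' A : K `<=` K' -> straddle K A `<=` straddle K' A.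
Proof. by move=> KK' z [[k /KK' ? ?] [l /KK' ? ?]]; split; [exists k|exists l]. Qed.

Lemma straddle_vH_boundary K A : straddle K A `<=` vH_boundary (K `|` mink_opp K) A.
Proof.
move=> z [[k Kk Ak] [l Kl nAl]]; have [Az|nAz] := pselect (A z).
  right; split => //; exists (z + l); first exact: subset_closure.
  by exists l; [left|rewrite addrK].
left; split; last by move/interior_subset.
exists (z + k) => //; exists (- k); last by rewrite addrK.
by right; exists k.
Qed.

Lemma straddle_mink_add K K0 A : mink_add (straddle K A) K0 `<=` straddle (mink_sub K K0) A.
Proof.
have zuk (z u k : G) : z + u + (k - u) = z + k by rewrite addrACA subrr addr0.
move=> _ [z [[k Kk Ak] [l Kl nAl]] [u Ku <-]]; split.
  by exists (k - u); [exists k => //; exists u|rewrite zuk].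
by exists (l - u); [exists l => //; exists u|rewrite zuk].
Qed.

Lemma shift_straddle a A B : B a -> shift a A `<=` A `|` straddle ([set 0] `|` B) A.
Proof.
move=> Ba x Ax; have [|nA] := pselect (A x); [by left|right].
by split; [exists a => //; right|exists 0; rewrite ?addr0//; left].
Qed.

Lemma straddle_shift a A B : B a -> A `<=` shift a A `|` straddle ([set 0] `|` B) A.
Proof.
move=> Ba x Ax; have [|nA] := pselect (shift a A x); [by left|right].
by split; [exists 0; rewrite ?addr0//; left|exists a => //; right].
Qed.

End Bounded.

Section Haar.
Variables (R : realType) (G : topologicalZmodType).
Variable mu : {measure set (borel G) -> \bar R}.
Hypotheses (mu_haar : haar_measure mu) (hG : hausdorff_space G).
Implicit Types (A K U : set G).

Lemma borel_open U : open U -> measurable (U : set (borel G)).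
Proof. by move=> oU; exact: (@sub_sigma_algebra _ setT (@open G) U oU). Qed.

Lemma borel_closed A : closed A -> measurable (A : set (borel G)).
Proof.
move=> cA; rewrite -[A]setCK; apply: (@measurableC _ (borel G)).
exact: (borel_open (closed_openC cA)).
Qed.

Lemma borel_compact K : compact K -> measurable (K : set (borel G)).
Proof. by move=> cK; apply: borel_closed; exact: compact_closed. Qed.

Lemma haar_compact_fin K : compact K -> mu K \is a fin_num.
Proof. by case: mu_haar => _ _ h _ _ cK; rewrite ge0_fin_numE// h. Qed.

Lemma haar_translate x A : measurable (A : set (borel G)) ->
  mu (translate x A) = mu A.
Proof. by case: mu_haar => _ + _ _ _; apply. Qed.

Lemma haar_compact_gt0 : exists2 K, compact K & (0 < mu K)%E.
Proof.
case: mu_haar => h0 _ _ _ hin.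
have := h0; rewrite (hin _ openT) => /ereal_sup_gt[_ [K [cK _] <-] ?].
by exists K.
Qed.

(** A compact set of positive measure is covered by finitely many translates of [U], one of which
    must then have positive measure. *)
Lemma haar_open_gt0 U : open U -> U 0 -> (0 < mu U)%E.
Proof.
move=> oU U0; have [K cK K0] := haar_compact_gt0.
have [|s _ sK] := @finite_cover G G setT (fun x => translate x U) K cK.
  move=> x _; exists x => //; apply: open_nbhs_nbhs; split.
    exact: open_translate.
  by exists 0; rewrite ?addr0.
have mU x : measurable (translate x U : set (borel G)).
  apply: borel_open; exact: open_translate.
have [|x _ Kx] := measure_cover_gt0 mU _ sK K0; first exact: borel_compact.
rewrite -(haar_translate x (borel_open oU)); apply: lt_le_trans Kx _.
apply: measure_mono; last exact: subIsetr; last exact: mU.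
by apply: measurableI => //; exact: borel_compact.
Qed.

End Haar.
(** * Densities of regular model sets *)

Section Density.
Variables (R : realType) (G Gint : topologicalZmodType).
Variables (mu : {measure set (borel G) -> \bar R}).
Variables (D : nat -> set G) (M : set (G * Gint)).
Hypotheses (lG : lcag G) (lGint : lcag Gint).
Hypotheses (mu_haar : haar_measure mu) (D_vH : van_Hove mu D).
Hypothesis M_subgroup : is_subgroup M.
Hypothesis M_discrete : exists U V, [/\ nbhs (0 : G) U, nbhs (0 : Gint) V &
  forall p, M p -> U p.1 -> V p.2 -> p = 0].
Implicit Types (Q Z : set G) (A C : set Gint) (m p : G * Gint).

Let hG : hausdorff_space G. Proof. by case: lG. Qed.
Let hGint : hausdorff_space Gint. Proof. by case: lGint. Qed.

Definition pts Q A := [set p | [/\ M p, Q p.1 & A p.2]].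

Lemma sub_pts Q Q' A A' : Q `<=` Q' -> A `<=` A' -> pts Q A `<=` pts Q' A'.
Proof. by move=> QQ' AA' p [Mp /QQ' ? /AA' ?]. Qed.

(** Packing argument. Split a compact set containing [C] into finitely many small cells and place a
    small open set [U] at each [p.1]. By discreteness of [M] these translates are disjoint for
    points in the same cell, so the number of cells bounds their multiplicity, and all of them lie
    in [Z]. *)
Lemma pts_count_le (K0 : set G) C : compact K0 -> nbhs 0 K0 -> bdd C ->
  exists2 c : R, 0 < c & forall Q Z, measurable (Z : set (borel G)) ->
    (mu Z < +oo)%E -> mink_add Q K0 `<=` Z ->
    finite_set (pts Q C) /\ nb R (pts Q C) <= c * fine (mu Z).
Proof.
move=> cK0 K00 [C' cC' CC'].
have [U0 [V0 [U00 V00 MUV]]] := M_discrete.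
have [U1 [U10 U1N U1D]] := nbhs0_half U00.
have [V1 [V10 V1N V1D]] := nbhs0_half V00.
pose U := interior (U1 `&` K0).
have oU : open U by exact: open_interior.
have U_0 : U 0 by apply: filterI.
have UU1 : U `<=` U1 by move=> x /interior_subset[].
have UK0 : U `<=` K0 by move=> x /interior_subset[].
have mU0 : (0 < mu U)%E by exact: haar_open_gt0.
have mUfin : mu U \is a fin_num.
  rewrite ge0_fin_numE//; apply: le_lt_trans (_ : mu K0 < +oo)%E.
    by apply: measure_mono => //; [exact: borel_open|exact: borel_compact].
  by rewrite -ge0_fin_numE//; exact: haar_compact_fin.
pose u := fine (mu U); have uE : mu U = u%:E by rewrite fineK.
have u0 : 0 < u by rewrite -lte_fin -uE.
have [|s _ sC] := @finite_cover Gint Gint setT (fun v => [set y | V1 (y - v)]) C' cC'.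
  by move=> v _; exists v => //; exact: nbhs_subl.
(* The successor only keeps the constant positive when the cover is empty. *)
exists ((size s).+1%:R / u) => [|Q Z mZ Zfin QZ]; first by rewrite divr_gt0.
apply: finite_set_bounded => F FQ.
have zfin : mu Z \is a fin_num by rewrite ge0_fin_numE.
rewrite mulrAC ler_pdivlMr// -lee_fin EFinM [leRHS]EFinM (fineK zfin).
pose E (p : G * Gint) : set (borel G) := translate p.1 U.
have mE p : measurable (E p) by apply: borel_open; exact: open_translate.
have EZ p : p \in F -> mu (E p `&` Z) = u%:E.
  move=> pF; rewrite setIidl ?haar_translate//; first exact: borel_open.
  move=> _ [a Ua <-]; apply: QZ; exists p.1; first by have [] := FQ _ pF.
  by exists a => //; exact: UK0.
have -> : ((#|` F|%:R)%:E * u%:E = \sum_(p <- F) mu (E p `&` Z))%E.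
  rewrite big_seq_cond (eq_bigr (fun=> u%:E)); last first.
    by move=> p /andP[pF _]; exact: EZ.
  rewrite -big_seq_cond sumEFin -EFinM; congr EFin.
  by rewrite big_const_seq count_predT iter_addr_0 mulr_natl cardfE -cardfE.
apply: sum_measure_le => // x Zx.
(* [f p] is the centre of a cell containing [p.2]; it is injective on the points whose translate of
   [U] contains [x]. *)
pose f p := xget 0 [set v | v \in s /\ V1 (p.2 - v)].
have fP p : p \in F -> f p \in s /\ V1 (p.2 - f p).
  move=> pF; have [_ _ /CC' Cp] := FQ _ pF; have [v vs Vp] := sC _ Cp.
  have : [set v | v \in s /\ V1 (p.2 - v)] (f p).
    by apply: xgetPex; exists v.
  by [].
rewrite (_ : \sum_(p <- F) _ = (size [seq f p | p <- F & x \in E p])%:R).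
  rewrite ler_nat leqW// uniq_leq_size//; last first.
    by move=> v /mapP[p]; rewrite mem_filter => /andP[_ /fP[? _]] ->.
  rewrite map_inj_in_uniq ?filter_uniq ?fset_uniq// => p q.
  rewrite !mem_filter => /andP[/set_mem[a Ua pax] pF] /andP[/set_mem[b Ub qbx] qF] fpq.
  apply/eqP; rewrite -subr_eq0; apply/eqP; apply: MUV.
  - by apply: M_subgroup.2; [have [] := FQ _ pF|have [] := FQ _ qF].
  - rewrite (_ : (p - q).1 = b + - a); first by apply: U1D; [|apply: U1N]; exact: UU1.
    by apply/eqP; rewrite /= subr_eq addrAC eq_sym subr_eq pax -qbx addrC.
  - rewrite (_ : (p - q).2 = (p.2 - f p) + - (q.2 - f q)).
      by apply: V1D; [|apply: V1N]; [have [] := fP _ pF|have [] := fP _ qF].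
    by rewrite fpq opprB addrA subrK.
rewrite size_map size_filter -sum1_count natr_sum [RHS]big_mkcond/=.
by apply: eq_bigr => p _; rewrite indicE; case: (x \in E p).
Qed.

Definition dn n : R := fine (mu (D n)).

Lemma compact_D n : compact (D n). Proof. by case: D_vH. Qed.

Lemma bdd_D n : bdd (D n). Proof. by exists (D n) => //; exact: compact_D. Qed.

Lemma mu_D n : mu (D n) = (dn n)%:E.
Proof. by rewrite fineK//; apply: haar_compact_fin => //; exact: compact_D. Qed.

Lemma dn_gt0 n : 0 < dn n.
Proof. by case: D_vH => _ _ h _; rewrite -lte_fin -mu_D. Qed.

Lemma vH_boundary_sub K n : vH_boundary K (D n) `<=` mink_add (D n) K `|` D n.
Proof. by move=> x [[]|[]]; [left|right]. Qed.

Lemma vH_boundary_measurable K n : compact K ->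
  measurable (vH_boundary K (D n) : set (borel G)).
Proof.
move=> cK; apply: (@measurableU _ (borel G)).
  apply: (@measurableD _ (borel G)).
    by apply: borel_compact => //; apply: compact_mink_add => //; exact: compact_D.
  by apply: borel_open; exact: open_interior.
apply: (@measurableI _ (borel G)).
  by apply: borel_closed; apply: closed_mink_sub => //; exact: closed_closure.
by apply: borel_compact => //; exact: compact_D.
Qed.

Lemma vH_boundary_fin K n : compact K -> (mu (vH_boundary K (D n)) < +oo)%E.
Proof.
move=> cK; have cDK : compact (mink_add (D n) K `|` D n).
  by apply: compactU; [apply: compact_mink_add => //|]; exact: compact_D.
apply: le_lt_trans (_ : mu (mink_add (D n) K `|` D n) < +oo)%E.
  apply: measure_mono; last exact: vH_boundary_sub.
    exact: vH_boundary_measurable.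
  exact: borel_compact.
by rewrite -ge0_fin_numE//; exact: haar_compact_fin.
Qed.

Lemma vH_boundary_small K (e : R) : compact K -> 0 < e ->
  \forall n \near \oo, fine (mu (vH_boundary K (D n))) <= e * dn n.
Proof.
move=> cK e0; case: D_vH => _ _ _ /(_ K cK) h.
have {}h : (fun n => fine (mu (vH_boundary K (D n))) / dn n) @ \oo --> (0 : R).
  have {}h : fine \o (fun n => mu (vH_boundary K (D n)) / mu (D n))%E @ \oo
      --> (0 : R) by exact: fine_cvg.
  apply: cvg_trans h; apply: near_eq_cvg; near=> n.
  rewrite /= mu_D inver gt_eqF ?dn_gt0//.
  have -> : mu (vH_boundary K (D n)) = (fine (mu (vH_boundary K (D n))))%:E.
    by rewrite fineK// ge0_fin_numE//; exact: vH_boundary_fin.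
  by rewrite -EFinM.
have : \forall n \near \oo, fine (mu (vH_boundary K (D n))) / dn n < e.
  exact: (cvgr_lt _ h).
by apply: filterS => n; rewrite ltr_pdivrMr ?dn_gt0// => /ltW.
Unshelve. all: by end_near.
Qed.

Lemma finite_pts Q C : bdd Q -> bdd C -> finite_set (pts Q C).
Proof.
move=> [Q' cQ' QQ'] bC; have [K0 cK0 K00] := compact_nbhs0 lG.
have [c _ /(_ Q' (mink_add Q' K0))] := pts_count_le cK0 K00 bC.
have cQK : compact (mink_add Q' K0) by exact: compact_mink_add.
case=> //; first by apply: borel_compact.
  by rewrite -ge0_fin_numE//; exact: haar_compact_fin.
by move=> fin _; apply: sub_finite_set fin; exact: sub_pts.
Qed.

(** The packing bound needs the region enlarged by [K0]. This enlargement is absorbed into [K], and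
    the result still lies in a van Hove boundary. *)
Lemma straddle_small K C (e : R) : bdd K -> bdd C -> 0 < e ->
  \forall n \near \oo, nb R (pts (straddle K (D n)) C) <= e * dn n.
Proof.
move=> [K' cK' KK'] bC e0; have [K0 cK0 K00] := compact_nbhs0 lG.
have [c c0 hc] := pts_count_le cK0 K00 bC.
pose K1 := mink_add K' (mink_opp K0).
have cK1 : compact K1.
  by apply: compact_mink_add => //; exact: compact_mink_opp.
have cK2 : compact (K1 `|` mink_opp K1).
  by apply: compactU => //; exact: compact_mink_opp.
have := vH_boundary_small cK2 (divr_gt0 e0 c0).
apply: filterS => n hn.
have [||_ /le_trans] := hc (straddle K (D n)) _ (vH_boundary_measurable n cK2).
- exact: vH_boundary_fin.
- move=> x Kx; apply: straddle_vH_boundary.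
  have sub : mink_sub K K0 `<=` K1.
    move=> _ [k Kk [l Kl <-]]; exists k; first exact: KK'.
    by exists (- l) => //; exists l.
  exact: (sub_straddle sub) (straddle_mink_add Kx).
apply; rewrite mulrC -ler_pdivlMr//.
by apply: le_trans hn _; rewrite mulrAC.
Qed.

Lemma pts_D_le C : bdd C -> exists2 c : R, 0 < c &
  \forall n \near \oo, nb R (pts (D n) C) <= c * dn n.
Proof.
move=> bC; have [K0 cK0 K00] := compact_nbhs0 lG.
have [c c0 hc] := pts_count_le cK0 K00 bC.
(* Eventually the boundary by [K0] has measure at most that of [D n], whence the factor 2. *)
exists (c * 2); first by rewrite mulr_gt0.
have := vH_boundary_small cK0 (@ltr01 R).
apply: filterS => n; rewrite mul1r => hn.
have mDn : measurable (D n : set (borel G)).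
  by apply: borel_compact => //; exact: compact_D.
have mvH := vH_boundary_measurable n cK0.
have muU : (mu (D n `|` vH_boundary K0 (D n)) <=
            (dn n)%:E + (fine (mu (vH_boundary K0 (D n))))%:E)%E.
  rewrite -mu_D fineK; first exact: (measureU2 mu mDn mvH).
  by rewrite ge0_fin_numE//; exact: vH_boundary_fin.
have mufin : (mu (D n `|` vH_boundary K0 (D n)) < +oo)%E.
  by apply: le_lt_trans muU _; rewrite -EFinD ltry.
have [||_ /le_trans] := hc (D n) (D n `|` vH_boundary K0 (D n)) _ mufin.
- exact: (@measurableU _ (borel G)).
- move=> x Dx; have [/interior_subset|nx] := pselect (interior (D n) x).
    by left.
  by right; left.
apply; rewrite -mulrA ler_pM2l// mulrDl mul1r.
rewrite -lee_fin fineK ?ge0_fin_numE//; apply: le_trans muU _.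
by rewrite -EFinD lee_fin lerD2l.
Qed.

Lemma pts_shift m Q A : M m ->
  pts Q A = (fun p => p + m) @` pts (shift m.1 Q) (shift m.2 A).
Proof.
move=> Mm; apply/seteqP; split => [p [Mp Qp Ap]|_ [p [Mp Qp Ap] <-]].
  exists (p - m); last by rewrite subrK.
  by split; [exact: M_subgroup.2|rewrite /shift /= subrK|rewrite /shift /= subrK].
by split => //; exact: is_subgroupD.
Qed.

(** Translation by [m] permutes [M]. This exchanges a shift of the window in [Gint] for a shift of
    the region in [G]. *)
Lemma nb_shift m Q A : bdd Q -> bdd A -> M m ->
  nb R (pts (shift m.1 Q) (shift m.2 A)) = nb R (pts Q A).
Proof.
move=> bQ bA Mm; rewrite [in RHS](pts_shift _ _ Mm) nb_image//.
  by apply: finite_pts; exact: bdd_shift.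
by move=> x y _ _; exact: addIr.
Qed.

(** [D n] and its shift by a point of [K] differ only at points straddling the boundary of [D n].
    The bound counts these over all of [C], hence is uniform in [a] and in [A]. *)
Lemma shift_close C (K : set G) (e : R) : bdd C -> bdd K -> 0 < e ->
  \forall n \near \oo, forall a A, K a -> A `<=` C ->
    `|nb R (pts (shift a (D n)) A) - nb R (pts (D n) A)| <= e * dn n.
Proof.
move=> bC bK e0; pose K1 := [set 0] `|` K.
have bK1 : bdd K1 by apply: bddU => //; apply: bdd_compact; exact: compact_set1.
apply: filterS (straddle_small bK1 bC e0) => n hn a A Ka AC.
have bA : bdd A by exact: bddS bC.
have fin : finite_set (pts (straddle K1 (D n)) C).
  by apply: finite_pts => //; apply: bdd_straddle => //; exact: bdd_D.
have fD : finite_set (pts (D n) A) by apply: finite_pts => //; exact: bdd_D.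
have fs : finite_set (pts (shift a (D n)) A).
  by apply: finite_pts => //; apply: bdd_shift; exact: bdd_D.
rewrite ler_norml lerBlDl lerNl opprB lerBlDl; apply/andP; split.
  apply: le_trans (nb_leD R fs fin _) _.
    move=> p [Mp Dp Ap]; have [?|?] := straddle_shift Ka Dp; first by left.
    by right; split => //; exact: AC.
  by rewrite lerD2l.
apply: le_trans (nb_leD R fD fin _) _.
  move=> p [Mp Dp Ap]; have [?|?] := shift_straddle Ka Dp; first by left.
  by right; split => //; exact: AC.
by rewrite lerD2l.
Qed.

(** * Null boundaries and small shifts in the internal space *)

Variable theta : {measure set (borel Gint) -> \bar R}.
Hypothesis theta_haar : haar_measure theta.
(** Weaker than density in [Gint]: [M] will be a sublattice of finite index, whose star image need
    not be dense. *)
Hypothesis M_dense : exists2 B, compact B &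
  (0 < theta B)%E /\ B `<=` closure (snd @` M).

Lemma haar_outer (K : set Gint) (e : R) : compact K -> theta K = 0%E -> 0 < e ->
  exists Y, [/\ open Y, K `<=` Y & (theta Y < e%:E)%E].
Proof.
case: theta_haar => _ _ _ hout _ cK K0 e0.
have := hout K (borel_compact hGint cK); rewrite K0 => inf0.
have : (ereal_inf [set theta U | U in [set U : set Gint | open U /\ K `<=` U]]
    < e%:E)%E by rewrite -inf0 lte_fin.
by move=> /ereal_inf_lt[_ [Y [oY KY] <-] ?]; exists Y.
Qed.

(* Shift K + U by lattice points m_i close to the cells F_i of a partition of B, and
   give these shifts the weights theta F_i. They have almost equal counts, while a
   point y is covered with weight at most theta (y - K - U - U). This is why the
   hypothesis bears on - K: inversion invariance of theta is not available. *)
Lemma null_compact_small (K : set Gint) (e : R) :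
  compact K -> theta (mink_opp K) = 0%E -> 0 < e ->
  exists U, [/\ nbhs 0 U, bdd U &
    \forall n \near \oo, nb R (pts (D n) (mink_add K U)) <= e * dn n].
Proof.
move=> cK thK e0; have [B cB [B0 BM]] := M_dense.
have [K0 cK0 K00] := compact_nbhs0 lGint.
have cKK0 := compact_mink_add cK cK0; have cBK0 := compact_mink_add cB cK0.
pose C := mink_add (mink_add K K0) (mink_add B K0).
have cC : compact C by exact: compact_mink_add.
have [c c0 hc] := pts_D_le (bdd_compact cC).
have Bfin : theta B \is a fin_num by exact: haar_compact_fin.
pose t := fine (theta B); have tE : theta B = t%:E by rewrite fineK.
have t0 : 0 < t by rewrite -lte_fin -tE.
(* This weight per point, times the bound [c * dn n] on the points over [C], is half of
   [t * (e * dn n)]; the other half pays for the shifts of [D n]. *)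
have dl0 : 0 < e * t / (2 * c) by rewrite divr_gt0 ?mulr_gt0.
have [Y [oY KY Ydl]] := haar_outer (compact_mink_opp cK) thK dl0.
have KY' : K `<=` mink_opp Y.
  by move=> x Kx; rewrite mink_opp_preimage; apply: KY; exists x.
have near0 := compact_nbhs_add cK (open_mink_opp oY) KY'.
have [U [U0 UN UD]] := nbhs0_half (filterI near0 K00).
have UK0 : U `<=` K0.
  by move=> u Uu; have [_] := UD u 0 Uu (nbhs_singleton U0); rewrite addr0.
pose V := interior U; have oV : open V by exact: open_interior.
(* Only lattice points close to [B] are used, so that the shifted windows stay in the fixed bounded
   set [C]. *)
pose s_ok := [set m | M m /\ exists2 h, B h & U (h - m.2)].
have [|s sok sB] :=
    @finite_cover Gint _ s_ok (fun m => [set y | V (y - m.2)]) B cB.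
  move=> h Bh; have V0 : nbhs 0 V by exact: nbhs_interior.
  have /closure_near0 /(_ V V0)[_ [m Mm <-] Vm] := BM h Bh.
  exists m; first by split=> //; exists h => //; exact: interior_subset.
  exact: (@subr_continuous _ m.2 h _ (open_nbhs_nbhs (conj oV Vm))).
pose mi i := nth 0 s i; pose N := size s.
have miS i : (i < N)%N -> s_ok (mi i) by move=> iN; apply/sok/mem_nth.
pose E i : set (borel Gint) := B `&` [set y | V (y - (mi i).2)].
have mE i : measurable (E i).
  apply: measurableI; first exact: borel_compact.
  by apply: borel_open; apply: open_comp => // ? _; exact: subr_continuous.
pose F := seqDU E; have mF i : measurable (F i) by exact: seqDU_measurable.
have FE i : F i `<=` E i by exact: subDsetl.
have tF : trivIset [set: nat] F by exact: trivIset_seqDU.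
have FB : \big[setU/set0]_(i < N) F i = B.
  rewrite -bigsetU_seqDU; apply/seteqP; split.
    by rewrite -bigcup_mkord => x [i _ []].
  move=> x Bx; have [m ms Vm] := sB x Bx.
  rewrite -bigcup_mkord; exists (index m s); first by rewrite /= index_mem.
  by split => //; rewrite /mi nth_index.
have Ffin i : theta (F i) \is a fin_num.
  rewrite ge0_fin_numE//; apply: le_lt_trans (_ : theta B < +oo)%E.
    by apply: measure_mono => //; [exact: borel_compact|move=> x /FE[]].
  by rewrite -ge0_fin_numE.
pose a i := fine (theta (F i)); have aE i : theta (F i) = (a i)%:E by rewrite fineK.
have a0 i : 0 <= a i by rewrite -lee_fin -aE.
have sumF (Q : pred nat) : (\sum_(i < N | Q i) a i)%:E =
    theta (\big[setU/set0]_(i < N | Q i) F i).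
  rewrite measure_bigsetU_ord//; last first.
    by move=> i j _ _ ij; apply/val_inj; exact: tF ij.
  by rewrite -sumEFin; apply: eq_bigr => i _; rewrite -aE.
have suma : \sum_(i < N) a i = t by apply/EFin_inj; rewrite (sumF xpredT) FB.
exists U; split => //; first by exists K0.
pose K1 := [set m.1 | m in [set` s]].
have bK1 : bdd K1.
  by apply/bdd_compact/finite_compact/finite_image; exact: finite_seq.
apply: filterS2 hc (shift_close (bdd_compact cKK0) bK1 (divr_gt0 e0 (ltr0Sn R 1))).
move=> n hc hs; pose A := mink_add K U.
have AKK0 : A `<=` mink_add K K0.
  by move=> _ [k Kk [u Uu <-]]; exists k => //; exists u => //; exact: UK0.
have bA : bdd A by exists (mink_add K K0).
rewrite -(ler_pM2l t0) -{1}suma mulr_suml.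
(* Shifting the window by [(mi i).2] amounts to shifting [D n] by [(mi i).1], one of finitely many
   elements of [G]. *)
have step1 (i : 'I_N) : a i * nb R (pts (D n) A) <=
    a i * nb R (pts (D n) (shift (- (mi i).2) A)) + a i * (e / 2 * dn n).
  rewrite -mulrDr ler_wpM2l//.
  have [Mmi _] := miS i (ltn_ord i).
  rewrite -(nb_shift (bdd_D n) (bdd_shift _ bA) Mmi) shift_shift subrr shift0.
  rewrite -lerBlDl; apply: le_trans (hs (mi i).1 A _ AKK0).
    by rewrite distrC ler_norm.
  by exists (mi i) => //; exact: mem_nth.
apply: le_trans (ler_sum _ (fun i _ => step1 i)) _.
rewrite big_split -mulr_suml suma /=.
have -> : t * (e * dn n) = e * t / (2 * c) * (c * dn n) + t * (e / 2 * dn n).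
  by field; rewrite gt_eqF.
rewrite lerD2r; apply: le_trans (_ : e * t / (2 * c) * nb R (pts (D n) C) <= _).
  have fP : finite_set (pts (D n) C).
    by apply: finite_pts; [exact: bdd_D|exact: bdd_compact].
  have AC (i : 'I_N) : shift (- (mi i).2) A `<=` C.
    move=> y Ay; have [_ [h Bh Uh]] := miS i (ltn_ord i).
    exists (y - (mi i).2); first exact: AKK0.
    exists (mi i).2; last by rewrite subrK.
    exists h => //; exists (- (h - (mi i).2)); first exact/UK0/UN.
    by rewrite opprB addrC subrK.
  under eq_bigr => i _.
    rewrite (nb_sum R fP (sub_pts _ (AC i)))// mulr_sumr; over.
  rewrite exchange_big /= /nb.
  rewrite (_ : _ * _ = \sum_(p <- fset_set (pts (D n) C)) (e * t / (2 * c))); last first.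
    by rewrite big_const_seq count_predT iter_addr_0 mulr_natr cardfE -cardfE.
  (* [Q] selects the shifted windows containing [p.2]. Their cells [F i] are disjoint and lie in p.2
     + Y, so their total weight is at most theta(Y). *)
  apply: ler_sum => p _; pose Q i := `[< A (p.2 - (mi i).2) >].
  apply: le_trans (_ : \sum_(i < N | Q i) a i <= _).
    rewrite [leRHS]big_mkcond /=; apply: ler_sum => i _.
    case: ifPn => [_|/asboolPn nA]; first by rewrite ler_piMr// lern1 leq_b1.
    by rewrite (_ : _ \in _ = false) ?mulr0//; apply/negP => /set_mem[].
  rewrite -lee_fin sumF; apply: le_trans (ltW Ydl).
  rewrite -(haar_translate theta_haar p.2 (borel_open oY)).
  apply: measure_mono.
  - by apply: bigsetU_measurable.
  - by apply: borel_open; exact: open_translate.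
  elim/big_ind : _ => [//|S S' SZ SZ' x [/SZ//|/SZ'//]|].
  move=> i /asboolP[k Kk [u Uu eqy]] x /FE[_ Vx].
  have Ux : U (x - (mi i).2) by exact: interior_subset.
  have [/(_ k Kk) + _] := UD u _ Uu (UN _ Ux).
  rewrite mink_opp_preimage translate_preimage /preimage /=; congr Y.
  by rewrite addrA eqy opprB opprB addrA subrK.
by rewrite ler_wpM2l// ltW.
Qed.

Lemma compact_closure A : bdd A -> compact (closure A).
Proof.
move=> [K cK AK]; apply: (subclosed_compact _ cK); first exact: closed_closure.
have /closure_id -> : closed K by exact: compact_closed.
exact: closureS.
Qed.

Lemma closed_frontier A : closed (frontier A).
Proof.
by rewrite /frontier setDE -closure_setC; apply: closedI; exact: closed_closure.
Qed.

(* U is chosen after V: in a disconnected group, A and its translate by u may differ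
   far from the frontier of A unless u is small enough. *)
Lemma null_boundary_small A (e : R) : bdd A ->
  theta (mink_opp (frontier A)) = 0%E -> 0 < e ->
  exists U V, [/\ nbhs 0 U, bdd U, bdd V,
    forall u, U u -> shift u A `<=` A `|` V /\ A `<=` shift u A `|` V &
    \forall n \near \oo, nb R (pts (D n) V) <= e * dn n].
Proof.
move=> bA thA e0; have cclA := compact_closure bA.
have cfA : compact (frontier A).
  by apply: subclosed_compact cclA _; [exact: closed_frontier|move=> x []].
have [U1 [U10 bU1 small]] := null_compact_small cfA thA e0.
pose V := [set y | exists2 b, frontier A b & interior U1 (y - b)].
have oV : open V.
  rewrite openE => y [b fb U1y].
  have : nbhs y [set z | interior U1 (z - b)].
    exact: (@subr_continuous _ b y _ (open_nbhs_nbhs (conj (@open_interior _ U1) U1y))).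
  by apply: filterS => z ?; exists b.
have VU1 : V `<=` mink_add (frontier A) U1.
  move=> y [b fb /interior_subset U1y]; exists b => //; exists (y - b) => //.
  by rewrite addrC subrK.
have bfU : bdd (mink_add (frontier A) U1).
  by apply: bdd_add => //; exact: bdd_compact.
have fV x : frontier A x -> V x.
  by move=> fx; exists x => //; rewrite subrr; exact: U10.
have clAV x : closure A x -> V x \/ interior A x.
  move=> clx; have [|nx] := pselect (interior A x); first by right.
  by left; apply: fV.
pose K := closure A `\` V.
have cK : compact K.
  apply: subclosed_compact cclA _; last by move=> x [].
  by rewrite /K setDE; apply: closedI; [exact: closed_closure|exact: open_closedC].
have KA : K `<=` interior A by move=> x [/clAV[]].
have near1 := compact_nbhs_add cK (@open_interior _ A) KA.
have near2 : \forall u \near (0 : Gint), forall k, closure A k -> (V `|` interior A) (k + u).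
  apply: (@compact_nbhs_add _ _ (V `|` interior A) cclA).
    by apply: openU => //; exact: open_interior.
  by move=> x /clAV[]; [left|right].
have [K0 cK0 K00] := compact_nbhs0 lGint.
(* The first condition puts [A] in the union of [shift u A] and [V]; the second puts [shift u A] in
   that of [A] and [V]; [K0] keeps the neighbourhood bounded. *)
exists ([set u | forall k, K k -> interior A (k + u)] `&`
  [set u | forall k, closure A k -> (V `|` interior A) (k + - u)] `&` K0), V; split.
- apply: filterI => //; apply: filterI => //.
  exact: (nbhs0_opp near2).
- by exists K0 => // u [].
- exact: bddS bfU.
- move=> u [[Ku clu] _]; split => y.
    move=> Ay; have /clu : closure A (y + u) by exact: (@subset_closure _ A).
    by rewrite addrK => -[|/interior_subset]; [right|left].
  move=> Ay; have [|nV] := pselect (V y); first by right.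
  left; have cAy : closure A y by exact: (@subset_closure _ A).
  exact: (@interior_subset _ A (y + u) (Ku y (conj cAy nV))).
- apply: filterS small => n; apply: le_trans; apply: nb_le; last exact: sub_pts.
  by apply: finite_pts => //; exact: bdd_D.
Qed.

Lemma nb_close (T : choiceType) (A B C : set T) :
  finite_set A -> finite_set B -> finite_set C ->
  A `<=` B `|` C -> B `<=` A `|` C -> `|nb R A - nb R B| <= nb R C.
Proof.
move=> fA fB fC AB BA; have := nb_leD R fB fC AB; have := nb_leD R fA fC BA.
by rewrite ler_norml; lra.
Qed.

(** Finitely many lattice points [m] approximate all of [K]. The shift by [m.2] is traded for a
    bounded shift of [D n], and the small remainder [k - m.2] only affects points with star image in
    [V]. *)
Lemma internal_shift_close A (K : set Gint) (e : R) : bdd A ->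
  theta (mink_opp (frontier A)) = 0%E -> compact K -> K `<=` closure (snd @` M) ->
  0 < e -> \forall n \near \oo, forall k, K k ->
    `|nb R (pts (D n) (shift k A)) - nb R (pts (D n) A)| <= e * dn n.
Proof.
move=> bA thA cK KM e0; have e20 : 0 < e / 2 by rewrite divr_gt0.
have [U [V [U0 bU bV UV small]]] := null_boundary_small bA thA e20.
have [|s sM sK] :=
    @finite_cover Gint _ M (fun m => [set y | U (y - m.2)]) K cK.
  move=> k Kk; have V0 : nbhs 0 (interior U) by exact: nbhs_interior.
  have /closure_near0 /(_ _ V0)[_ [m Mm <-] Um] := KM k Kk; exists m => //.
  exact: (@subr_continuous _ m.2 k _ Um).
pose K1 := [set - m.1 | m in [set` s]].
have bK1 : bdd K1.
  by apply/bdd_compact/finite_compact/finite_image; exact: finite_seq.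
have bC := bdd_shifts bA bU.
apply: filterS2 small (shift_close bC bK1 e20) => n hV hs k Kk.
have [m ms Um] := sK k Kk; have Mm := sM _ ms.
pose u := k - m.2; have bs : bdd (shift u A) by exact: bdd_shift.
have kE : shift k A = shift m.2 (shift u A) by rewrite shift_shift addrC subrK.
have h1 : nb R (pts (D n) (shift k A)) = nb R (pts (shift (- m.1) (D n)) (shift u A)).
  rewrite -[RHS](nb_shift _ _ Mm) ?shift_shift ?addrN ?shift0//.
    by rewrite (addrC m.2) subrK.
  by apply: bdd_shift; exact: bdd_D.
have h2 := hs (- m.1) (shift u A).
have /h2 {}h2 : K1 (- m.1) by exists m.
have {}h2 : shift u A `<=` [set x | exists2 b, U b & A (x + b)] by move=> x ?; exists u.
have := hs (- m.1) _ (ex_intro2 _ _ m ms erefl) h2; rewrite -h1.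
have [UVl UVr] := UV u Um.
have fV : finite_set (pts (D n) V) by apply: finite_pts => //; exact: bdd_D.
have fA : finite_set (pts (D n) A) by apply: finite_pts => //; exact: bdd_D.
have fS : finite_set (pts (D n) (shift u A)) by apply: finite_pts => //; exact: bdd_D.
have : `|nb R (pts (D n) (shift u A)) - nb R (pts (D n) A)| <= nb R (pts (D n) V).
  apply: nb_close => // p [Mp Dp].
    by move=> /UVl[?|?]; [left|right].
  by move=> /UVr[?|?]; [left|right].
rewrite !ler_norml; move: hV; lra.
Qed.

(** * Uniform counts and existence of densities *)

Hypothesis M_cocompact : exists K1 K2, [/\ compact K1, compact K2 &
  forall x y, exists2 m, M m & K1 (x - m.1) /\ K2 (y - m.2)].

(** Subtracting a suitable lattice point turns an arbitrary translate of [D n] into a bounded one,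
    at the price of a bounded shift of [A]; both are already controlled. *)
Lemma uniform_count A (e : R) : bdd A -> theta (mink_opp (frontier A)) = 0%E ->
  0 < e -> \forall n \near \oo, forall x,
    `|nb R (pts (shift x (D n)) A) - nb R (pts (D n) A)| <= e * dn n.
Proof.
move=> bA thA e0; have e20 : 0 < e / 2 by rewrite divr_gt0.
have [K1 [K2 [cK1 cK2 cov]]] := M_cocompact.
pose K := K2 `&` closure (snd @` M).
have cK : compact K by apply: compact_closedI => //; exact: closed_closure.
have bC := bdd_shifts bA (bdd_compact cK).
have near1 := internal_shift_close bA thA cK (@subIsetr _ _ _) e20.
apply: filterS2 near1 (shift_close bC (bdd_compact cK1) e20) => n h1 h2 x.
(* Second coordinate [0]: then [- m.2] is both in the compact set [K2] and in the star image of [M],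
   as the previous lemma requires. *)
have [m Mm []] := cov x 0; rewrite sub0r => K1m K2m.
have Km : K (- m.2).
  split=> //; apply: subset_closure; exists (- m) => //.
  exact: is_subgroupN.
have -> : nb R (pts (shift x (D n)) A) =
    nb R (pts (shift (x - m.1) (D n)) (shift (- m.2) A)).
  rewrite -[RHS](nb_shift _ _ Mm) ?shift_shift ?addrN ?shift0//.
  - by rewrite addrC subrK.
  - by apply: bdd_shift; exact: bdd_D.
  - exact: bdd_shift.
have sub : shift (- m.2) A `<=` [set x | exists2 b, K b & A (x + b)].
  by move=> y ?; exists (- m.2).
have := h2 _ _ K1m sub; have := h1 _ Km; rewrite !ler_norml; lra.
Qed.

(** Double counting meets [D m] reflected about [x]. The symmetry p -> -p of [M] undoes this and
    reflects the window instead. *)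
Lemma nb_reflect (x : G) (m : nat) A : bdd A ->
  nb R (pts [set z | D m (x - z)] A) = nb R (pts (shift x (D m)) (mink_opp A)).
Proof.
move=> bA; rewrite -[RHS](nb_image R (f := -%R)).
- congr nb; apply/seteqP; split => [p [Mp Dp Ap]|_ [p [Mp Dp [a Aa ap]] <-]].
    exists (- p); last by rewrite opprK.
    split; [exact: is_subgroupN| |by exists p.2].
    by rewrite /shift /= addrC.
  split; [exact: is_subgroupN| |by rewrite /= -ap opprK].
  by rewrite /= opprK addrC.
- apply: finite_pts; last exact: bdd_opp.
  by apply: bdd_shift; exact: bdd_D.
- by move=> ? ? _ _; exact: oppr_inj.
Qed.

(* Both terms are compared with the sum over p of the measure of
   D n `&` (p.1 + D m), which is the integral over D n of the number of points p
   such that D m (x - p.1). *)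
Lemma double_count A (m n : nat) (ka e : R) : bdd A -> 0 <= e ->
  (forall x, `|nb R (pts [set z | D m (x - z)] A) - ka| <= e * dn m) ->
  nb R (pts (straddle ([set 0] `|` D m) (D n)) A) <= e * dn n ->
  `|nb R (pts (D n) A) * dn m - ka * dn n| <= 2 * e * dn m * dn n.
Proof.
move=> bA e0 hm hn.
pose K := [set 0] `|` D m.
(* [Q] contains [D n] and every [z] for which z + D m meets [D n]. *)
pose Q := [set z | exists2 k, K k & D n (z + k)].
have bK : bdd K.
  by apply: bddU; [apply: bdd_compact; exact: compact_set1|exact: bdd_D].
have bQ : bdd Q by apply: bdd_shifts => //; exact: bdd_D.
have fP : finite_set (pts Q A) by exact: finite_pts.
pose P := fset_set (pts Q A).
have PP p : p \in P -> pts Q A p by rewrite in_fset_set// => /set_mem.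
pose E (p : G * Gint) : set (borel G) := translate p.1 (D m).
have mD k : measurable (D k : set (borel G)).
  by apply: borel_compact => //; exact: compact_D.
have mE p : measurable (E p).
  by apply: borel_compact => //; apply: compact_translate; exact: compact_D.
have muE p : mu (E p) = (dn m)%:E by rewrite haar_translate// mu_D.
have leE p : (mu (E p `&` D n) <= (dn m)%:E)%E.
  by rewrite -(muE p); apply: measure_mono => //; exact: measurableI.
pose j p := fine (mu (E p `&` D n)).
have jE p : mu (E p `&` D n) = (j p)%:E.
  by rewrite fineK// ge0_fin_numE//; apply: le_lt_trans (leE p) _; rewrite ltry.
have j0 p : 0 <= j p by rewrite -lee_fin -jE.
have jm p : j p <= dn m by rewrite -lee_fin -jE.
have sumj : (\sum_(p <- P) mu (E p `&` D n) = (\sum_(p <- P) j p)%:E)%E.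
  by rewrite -sumEFin; apply: eq_bigr.
have count x : D n x ->
    \sum_(p <- P) \1_(E p) x = nb R (pts [set z | D m (x - z)] A).
  move=> Dx; rewrite (nb_sum R fP); last first.
    move=> p [Mp Dp Ap]; split=> //; exists (x - p.1); first by right.
    by rewrite addrC subrK.
  apply: eq_big_seq => p /PP[Mp Qp Ap]; rewrite indicE; congr (_%:R); congr nat_of_bool.
  rewrite /E translate_preimage; apply/idP/idP => /set_mem h; apply/mem_set => //.
  by case: h.
have up : \sum_(p <- P) j p <= (ka + e * dn m) * dn n.
  rewrite -lee_fin -sumj EFinM -mu_D; apply: sum_measure_le => //.
    have := hm 0; rewrite ler_norml => /andP[_]; rewrite lerBlDl.
    by apply: le_trans; exact: nb_ge0.
  by move=> x Dx; rewrite count//; have := hm x; rewrite ler_norml lerBlDl => /andP[].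
have low : (ka - e * dn m) * dn n <= \sum_(p <- P) j p.
  (* The lower multiplicity bound applies to nonnegative constants only; for the others the claim is
     trivial. *)
  have [k0|k0] := leP (ka - e * dn m) 0.
    apply: le_trans (_ : 0 <= _); last exact: sumr_ge0.
    by rewrite mulr_le0_ge0// ltW// dn_gt0.
  rewrite -lee_fin -sumj EFinM -mu_D; apply: sum_measure_ge => //; first exact: ltW.
  move=> x Dx; rewrite count//; have := hm x.
  by rewrite ler_norml => /andP[+ _]; rewrite lerNl opprB lerBlDr -lerBlDl.
have close : `|\sum_(p <- P) j p - nb R (pts (D n) A) * dn m| <=
             dn m * nb R (pts (straddle K (D n)) A).
  have subD : pts (D n) A `<=` pts Q A.
    by apply: sub_pts => // z Dz; exists 0; [left|rewrite addr0].
  have subB : pts (straddle K (D n)) A `<=` pts Q A by apply: sub_pts => // z [].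
  rewrite (nb_sum R fP subD) (nb_sum R fP subB) mulr_suml mulr_sumr -sumrB.
  apply: le_trans (ler_norm_sum _ _ _) _; rewrite big_seq [leRHS]big_seq.
  apply: ler_sum => p /PP[Mp Qp Ap].
  have [bp|nb] := pselect (pts (straddle K (D n)) A p).
    rewrite (mem_set bp) mulr1 ler_norml; have := j0 p; have := jm p.
    by case: (p \in _); rewrite ?mul1r ?mul0r; lra.
  (* If [p.1] does not straddle, then p.1 + D m lies inside [D n] or misses it, according to whether
     [p.1] is in [D n]: the two terms agree exactly. *)
  have nbd k l : K k -> K l -> D n (p.1 + k) -> D n (p.1 + l).
    move=> Kk Kl Dk; apply: contrapT => nDl; apply: nb; split => //.
    by split; [exists k|exists l].
  have [Dp|nDp] := pselect (D n p.1).
    rewrite (mem_set (_ : pts (D n) A p))// mul1r.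
    suff -> : j p = dn m by rewrite subrr normr0 mulr_ge0// ltW// dn_gt0.
    apply/EFin_inj; rewrite -jE -(muE p); congr (mu _); apply: setIidl.
    move=> _ [d Dd <-]; apply: (nbd 0); [by left|by right|by rewrite addr0].
  rewrite (_ : p \in pts (D n) A = false); last by apply/negP => /set_mem[].
  suff -> : j p = 0 by rewrite mul0r subrr normr0 mulr_ge0// ltW// dn_gt0.
  apply/EFin_inj; rewrite -jE (_ : _ `&` _ = set0) ?measure0//.
  apply/seteqP; split => // x [[d Dd <-] Dx]; apply: nDp.
  by rewrite -[p.1]addr0; apply: (nbd d) => //; [right|left].
have := ler_wpM2l (ltW (dn_gt0 m)) hn; move: close up low; rewrite !ler_norml -/K.
by move=> /andP[c1 c2] up low hn'; apply/andP; split; lra.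
Qed.

(** The reflection of the window in [nb_reflect] cancels the one in the hypothesis of
    [uniform_count], so the condition falls on [frontier A] itself. *)
Lemma density_exists A : bdd A -> theta (frontier A) = 0%E ->
  exists l : R, nb R (pts (D n) A) / dn n @[n --> \oo] --> l.
Proof.
move=> bA thA; have bNA := bdd_opp bA.
have thNA : theta (mink_opp (frontier (mink_opp A))) = 0%E.
  rewrite frontier_opp !mink_opp_preimage -comp_preimage.
  by rewrite (_ : -%R \o -%R = id) ?preimage_id//; apply/funext => ?; exact: opprK.
apply/cvg_ex; apply: cauchy_cvg; apply: cauchy_exP => e e0.
have e30 : 0 < e / 3 by rewrite divr_gt0.
(* A single [m] with nearly equal counts over all translates of [D m] supplies the centre
   [ka / dn m] of the Cauchy ball. With e / 3 the double count errs by 2 e / 3 < e. *)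
have [m _ /(_ m (leqnn m)) hm] := uniform_count bNA thNA e30.
pose ka := nb R (pts (D m) (mink_opp A)).
exists (ka / dn m).
have bK : bdd ([set 0] `|` D m).
  by apply: bddU; [apply: bdd_compact; exact: compact_set1|exact: bdd_D].
apply: filterS (straddle_small bK bA e30) => n hn.
have hm' x : `|nb R (pts [set z | D m (x - z)] A) - ka| <= e / 3 * dn m.
  by rewrite nb_reflect.
have := double_count bA (ltW e30) hm' hn.
have dm0 := dn_gt0 m; have dn0 := dn_gt0 n.
move=> h; suff : `|nb R (pts (D n) A) / dn n - ka / dn m| < e.
  by rewrite /mkset -ball_normE /ball_ /= distrC.
have -> : nb R (pts (D n) A) / dn n - ka / dn m =
    (nb R (pts (D n) A) * dn m - ka * dn n) / (dn m * dn n).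
  by field; rewrite !gt_eqF.
rewrite normrM normfV (gtr0_norm (mulr_gt0 dm0 dn0)) ltr_pdivrMr ?mulr_gt0//.
apply: le_lt_trans h _; rewrite -mulrA ltr_pM2r ?mulr_gt0//; lra.
Qed.

Lemma shifted_density_exists (a : G) A : bdd A -> theta (frontier A) = 0%E ->
  exists l : R, nb R (pts (shift a (D n)) A) / dn n @[n --> \oo] --> l.
Proof.
move=> bA thA; have [l hl] := density_exists bA thA; exists l.
apply/cvgrPdist_le => e e0; have e20 : 0 < e / 2 by rewrite divr_gt0.
have ba : bdd [set a] by apply: bdd_compact; exact: compact_set1.
have /cvgrPdist_le /(_ _ e20) := hl.
apply: filterS2 (shift_close bA ba e20) => n /(_ a A erefl (@subset_refl _ A)) h1 h2.
have dn0 := dn_gt0 n.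
have : `|nb R (pts (shift a (D n)) A) / dn n - nb R (pts (D n) A) / dn n| <= e / 2.
  by rewrite -mulrBl normrM normfV (gtr0_norm dn0) ler_pdivrMr.
by move: h2; rewrite !ler_norml; lra.
Qed.

End Density.

(** * Independence of products *)

Section ComplexBase.
Variable R : realType.

(** A countable base of the complex plane: rational centres and radii 1 / (n + 1). *)
Definition rat_ball (b : rat * rat * nat) : set (R[i]^o) :=
  ball (Complex (ratr b.1.1) (ratr b.1.2) : R[i]^o) (b.2.+1%:R^-1).

Lemma norm_complex_le (z : R[i]) :
  `|z| <= (`|complex.Re z| + `|complex.Im z|)%:C%C.
Proof.
rewrite normc_def lecR -[leRHS]ger0_norm ?addr_ge0// -sqrtr_sqr ler_sqrt ?sqr_ge0//.
rewrite sqrrD !real_normK ?num_real//.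
by rewrite addrAC lerDl mulrn_wge0// mulr_ge0.
Qed.

Lemma natrC (n : nat) : (n%:R : R[i]) = (n%:R)%:C%C.
Proof. by rewrite rmorph_nat. Qed.

Lemma rat_ball_basis (Y : set (R[i]^o)) z : open Y -> Y z ->
  exists b, rat_ball b z /\ rat_ball b `<=` Y.
Proof.
move=> oY Yz; have /nbhs_ballP[e /= e0 eY] := open_nbhs_nbhs (conj oY Yz).
(* Radii are complex numbers here; positivity makes [e] real. *)
have eE : e = (complex.Re e)%:C%C by apply/esym/RRe_real/ger0_real/ltW.
have re0 : 0 < complex.Re e by rewrite -ltcR -eE.
pose n := Num.truncn (2 / complex.Re e).
have n0 : 0 < n.+1%:R^-1 :> R by rewrite invr_gt0.
have en : n.+1%:R^-1 * 2 < complex.Re e.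
  by rewrite mulrC ltr_pdivrMr// mulrC -ltr_pdivrMr// truncnS_gt.
have rat_near (x : R) : exists q : rat, `|ratr q - x| < n.+1%:R^-1 / 2.
  have [|q] := @rat_in_itvoo R (x - n.+1%:R^-1 / 2) (x + n.+1%:R^-1 / 2).
    by rewrite ltrD2l gtrN// divr_gt0.
  by rewrite in_itv /= => qx; exists q; rewrite ltr_distl.
have [p hp] := rat_near (complex.Re z); have [q hq] := rat_near (complex.Im z).
have nE : (n.+1%:R^-1 : R[i]) = (n.+1%:R^-1)%:C%C.
  by rewrite natrC fmorphV.
have bz : rat_ball (p, q, n) z.
  rewrite /rat_ball -ball_normE /ball_ /= nE; apply: le_lt_trans (norm_complex_le _) _.
  by rewrite ltcR !raddfB /= [ltRHS]splitr ltrD.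
exists (p, q, n); split => // y by_; apply: eY.
move: bz by_; rewrite /rat_ball -!ball_normE /ball_ /= => bz by_.
rewrite -[z](subrK (Complex (ratr p) (ratr q))) -addrA.
apply: le_lt_trans (ler_normD _ _) _; rewrite distrC.
apply: lt_trans (ltrD bz by_) _.
by rewrite nE -rmorphD eE ltcR; move: en; rewrite mulr_natr mulr2n.
Qed.

Lemma mulJ_continuous :
  continuous (fun z : (R[i]^o * R[i]^o)%type => (z.1 * (z.2)^*%C : R[i]^o)).
Proof.
move=> z; apply: (@cvgM R[i] _ (nbhs z) _ (fun z => z.1) (fun z => (z.2)^*%C)
  z.1 (z.2)^*%C).
  exact: cvg_fst.
apply: (@continuous_comp _ _ _ snd (fun y : R[i]^o => y^*%C : R[i]^o)).
  exact: cvg_snd.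
move=> A /nbhs_ballP[e /= e0 eA]; apply/nbhs_ballP; exists e => // y yz.
apply: eA; move: yz; rewrite -!ball_normE /ball_ /=.
by rewrite -rmorphB normcJ.
Qed.

End ComplexBase.

Section Independence.
Variables (R : realType) (d : measure_display) (T : measurableType d).
Variables (P : probability T R) (G : choiceType).
Variable X : G -> T -> R[i].

Lemma sigma_algebra_of_mono (A B : set G) : A `<=` B ->
  sigma_algebra_of X A `<=` sigma_algebra_of X B.
Proof. by move=> AB; apply: sub_sigma_algebra2; exact: bigcup_subset. Qed.

Lemma sigma_algebra_ofI (A : set G) E F : sigma_algebra_of X A E ->
  sigma_algebra_of X A F -> sigma_algebra_of X A (E `&` F).
Proof.
pose GG := \bigcup_(s in A)
  preimage_set_system setT (X s : T -> borel (R[i]^o)) measurable.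
exact: (@measurableI _ (g_sigma_algebraType GG)).
Qed.

Lemma sigma_algebra_ofT (A : set G) : sigma_algebra_of X A setT.
Proof.
pose GG := \bigcup_(s in A)
  preimage_set_system setT (X s : T -> borel (R[i]^o)) measurable.
exact: (@measurableT _ (g_sigma_algebraType GG)).
Qed.

(** The preimage of an open set under (z, w) -> z * conj w is open, hence a countable union of
    products of balls of the base; each product pulls back to an intersection of two generators.
    [T'] is [T] with the generated sigma-algebra. *)
Lemma mulJ_sigma (A : set G) s t (B : set (borel (R[i]^o))) :
  A s -> A t -> measurable B ->
  sigma_algebra_of X A ((fun w => X s w * (X t w)^*%C) @^-1` B).
Proof.
move=> As At mB.
pose GG := \bigcup_(s in A)
  preimage_set_system setT (X s : T -> borel (R[i]^o)) measurable.
pose T' := g_sigma_algebraType GG.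
have mX u (Y : set (R[i]^o)) : A u -> open Y -> measurable (X u @^-1` Y : set T').
  move=> Au oY; apply: sub_sigma_algebra; exists u => //.
  exists Y; last by rewrite setTI.
  exact: (@sub_sigma_algebra _ setT (@open (R[i]^o)) Y oY).
suff mf : measurable_fun setT (fun w : T' => X s w * (X t w)^*%C : borel (R[i]^o)).
  by have := mf (@measurableT _ T') B mB; rewrite setTI.
apply: (@measurability _ _ T' (borel (R[i]^o)) setT _ (@open (R[i]^o)) erefl).
move=> _ [Y oY <-]; rewrite setTI.
pose h (z : R[i]^o * R[i]^o) : R[i]^o := z.1 * (z.2)^*%C.
have oh : open (h @^-1` Y).
  by apply: open_comp => // z _; exact: mulJ_continuous.
pose F (b : (rat * rat * nat) * (rat * rat * nat)) : set T' :=
  if `[< rat_ball b.1 `*` rat_ball b.2 `<=` h @^-1` Y >]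
  then X s @^-1` rat_ball b.1 `&` X t @^-1` rat_ball b.2 else set0.
rewrite (_ : _ @^-1` Y = \bigcup_b F b).
  apply: countable_bigcupT_measurable => [|b]; first exact: countableP.
  rewrite /F; case: ifP => _; last exact: measurable0.
  by apply: measurableI; apply: mX => //; exact: ball_open.
apply/seteqP; split => [w Yw|w [b _]]; last first.
  by rewrite /F; case: ifPn => // /asboolP sub [? ?]; apply: (sub (X s w, X t w)).
have := open_nbhs_nbhs (conj oh (Yw : (h @^-1` Y) (X s w, X t w))).
move=> [[U V] /= [Us Vt] UV].
have [b [bs bU]] := rat_ball_basis (@open_interior _ U) (Us : interior U (X s w)).
have [c [ct cV]] := rat_ball_basis (@open_interior _ V) (Vt : interior V (X t w)).
exists (b, c) => //; rewrite /F; case: ifPn => // /asboolPn; apply: contra_notP => _.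
by move=> z [/bU/interior_subset ? /cV/interior_subset ?]; exact: UV.
Qed.

End Independence.

(** Factors are split off one at a time. The product at [i] depends on [X] at i and i - g, the
    remaining ones on [X] at the points j and j - g; the differences between the two groups are i -
    j, i - j + g and i - j - g, all outside [D]. *)
Lemma independent_products (R : realType) (d : measure_display)
    (T : measurableType d) (P : probability T R) (G : topologicalZmodType)
    (X : G -> T -> R[i]) (S D Q : set G) (g : G) :
  d_set P X S D -> (forall s, Q s -> S s /\ S (s - g)) ->
  (forall s t, Q s -> Q t -> s != t ->
    [/\ ~ D (s - t), ~ D (s - t + g) & ~ D (s - t - g)]) ->
  independent_family P (fun s w => X s w * (X (s - g) w)^*%C) Q.
Proof.
move=> [_ _ indep] QS QD J B JQ mB.
pose Y s w := X s w * (X (s - g) w)^*%C.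
pose A (l : seq G) := [set` l] `|` [set i - g | i in [set` l]].
pose E (l : seq G) := [set w | forall i, i \in l -> B i (Y i w)].
have finA l : finite_set (A l).
  rewrite /A finite_setU; split; first exact: finite_seq.
  by apply: finite_image; exact: finite_seq.
have AS l : (forall i, i \in l -> Q i) -> A l `<=` S.
  by move=> lQ _ [/lQ/QS[]//|[i /lQ/QS[_ ?] <-]].
have step l : uniq l -> (forall i, i \in l -> Q i) ->
    sigma_algebra_of X (A l) (E l) /\
    P (E l) = (\prod_(i <- l) P (Y i @^-1` B i))%E.
  elim: l => [_ _|i l IH /andP[il ul] lQ].
    rewrite big_nil -(@probability_setT _ _ _ P) (_ : E [::] = setT); last first.
      by apply/seteqP; split => // w _ j.
    by split => //; exact: sigma_algebra_ofT.
  have lQ' j : j \in l -> Q j by move=> jl; apply: lQ; rewrite inE jl orbT.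
  have [sE PE] := IH ul lQ'.
  have Qi : Q i by apply: lQ; rewrite mem_head.
  have EE : E (i :: l) = Y i @^-1` B i `&` E l.
    apply/seteqP; split => [w h|w [hi hl] j].
      split; first by apply: h; rewrite mem_head.
      by move=> j jl; apply: h; rewrite inE jl orbT.
    by rewrite inE => /orP[/eqP->|/hl].
  have si : sigma_algebra_of X (A [:: i]) (Y i @^-1` B i).
    by apply: mulJ_sigma => //; [left|right; exists i] => //=; rewrite mem_head.
  split.
    rewrite EE; apply: sigma_algebra_ofI.
      apply: sigma_algebra_of_mono si => x [|[j + <-]]; rewrite /= mem_seq1 => /eqP->.
        by left; rewrite /= mem_head.
      by right; exists i => //=; rewrite mem_head.
    apply: sigma_algebra_of_mono sE => j [jl|[k jl <-]].
      by left; rewrite /= inE jl orbT.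
    by right; exists k => //=; rewrite inE jl orbT.
  rewrite big_cons EE -PE; apply: (indep (A [:: i]) (A l)) => //.
  - by apply: AS => j; rewrite inE => /eqP->.
  - exact: AS.
  apply/seteqP; split => // x [[a Aa [b Ab abx]] Dx].
  have key j : j \in l -> [/\ ~ D (i - j), ~ D (i - j + g) & ~ D (i - j - g)].
    move=> jl; apply: QD => //; first exact: lQ'.
    by apply: contraNneq il => ->.
  move: Aa Ab; rewrite /A /= => -[|[i']] /=; rewrite mem_seq1 => /eqP.
    move=> ai [/key[h1 _ _]|[j /key[_ h2 _] bj]].
      by apply: h1; rewrite -ai abx.
    by apply: h2; rewrite addrAC -addrA -opprB bj -ai abx.
  move=> -> ai [/key[_ _ h3]|[j /key[h1 _ _] bj]].
    by apply: h3; rewrite addrAC ai abx.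
  by apply: h1; rewrite -abx -ai -bj opprB addrA subrK in Dx.
have [_ <-] := step (enum_fset J) (fset_uniq J) (fun i iJ => JQ i iJ).
by congr (P _); apply/seteqP; split => w h i; exact: h.
Qed.

(** * Lattices, closed subgroups and subschemes *)

Lemma open_setX (T U : topologicalType) (A : set T) (B : set U) :
  open A -> open B -> open (A `*` B).
Proof.
move=> oA oB; rewrite (_ : A `*` B = fst @^-1` A `&` snd @^-1` B)//.
by apply: openI; apply: open_comp => // z _; [exact: cvg_fst|exact: cvg_snd].
Qed.

Lemma zmodClosed_of_subgroup (V : zmodType) (A : set V) : is_subgroup A ->
  exists H : zmodClosed V, forall x, x \in H <-> A x.
Proof.
move=> [A0 AB]; pose p : {pred V} := [pred x | `[< A x >]].
have h : GRing.zmod_closed p.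
  by split=> [|x y /asboolP Ax /asboolP Ay]; apply/asboolP => //; exact: AB.
pose H := HB.pack_for (zmodClosed V) p (GRing.isZmodClosed.Build V p h).
by exists H => x; split => /asboolP.
Qed.

Section Lattice.
Variables G Gint : topologicalZmodType.
Variable L : zmodClosed (G * Gint)%type.

Lemma proj_lattice_subgroup : is_subgroup (proj_lattice L).
Proof.
split=> [|_ _ [x Lx <-] [y Ly <-]]; first by exists 0; rewrite /= ?rpred0.
by exists (x - y) => //; rewrite /= rpredB.
Qed.

Lemma lattice_discrete : isolated [set` L] = [set` L] ->
  exists U V, [/\ nbhs (0 : G) U, nbhs (0 : Gint) V &
    forall p, p \in L -> U p.1 -> V p.2 -> p = 0].
Proof.
move=> iL; have : [set` L] 0 by rewrite /= rpred0.
rewrite -iL => -[_ [Y [[U V] /= [U0 V0] UV] YL]]; exists U, V; split => // p pL Up Vp.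
have : (Y `&` [set` L]) p by split => //; exact: (UV p (conj Up Vp)).
by rewrite YL.
Qed.

Lemma lattice_isolated : (exists U V, [/\ nbhs (0 : G) U, nbhs (0 : Gint) V &
    forall p, p \in L -> U p.1 -> V p.2 -> p = 0]) ->
  isolated [set` L] = [set` L].
Proof.
move=> [U [V [U0 V0 UV]]]; apply/seteqP; split => [|p pL]; first exact: isolatedS.
split; first exact: mem_set.
exists [set q | U (q.1 - p.1) /\ V (q.2 - p.2)].
  exists ([set x | U (x - p.1)], [set y | V (y - p.2)]).
    by split; exact: nbhs_subl.
  by case=> a b [].
apply/seteqP; split => [q [[Uq Vq] qL]|_ ->]; last first.
  by rewrite /= !subrr; do !split => //; exact: nbhs_singleton.
by apply/eqP; rewrite -subr_eq0; apply/eqP/UV => //; exact: rpredB.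
Qed.

Local Notation Q := (quotient_topology (Quotient.quot L)).
Local Notation piQ := (\pi_Q%qT : G * Gint -> Q).

Lemma pi_eq x y : piQ x = piQ y <-> x - y \in L.
Proof. by rewrite Quotient.idealrBE; split => [h|/eqP h]; [apply/eqP; exact: h|exact: h]. Qed.

(** The quotient map is open, since the saturation of an open box is a union of its translates by
    [L]; so finitely many translated boxes cover the quotient. *)
Lemma compact_quotient_cover (K1 : set G) (K2 : set Gint) :
  nbhs 0 K1 -> nbhs 0 K2 -> compact [set: Q] ->
  exists s : seq (G * Gint), forall x, exists2 c, c \in s &
    exists2 m, m \in L & K1 (x.1 - m.1 - c.1) /\ K2 (x.2 - m.2 - c.2).
Proof.
move=> K10 K20 cQ.
pose U : set (G * Gint) := interior K1 `*` interior K2.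
have oU : open U by apply: open_setX; exact: open_interior.
have [|s _ sQ] :=
    @finite_cover Q (G * Gint)%type setT (fun c => piQ @` [set z | U (z - c)]) setT cQ.
  move=> q _; exists (repr q) => //; apply: open_nbhs_nbhs; split; last first.
    exists (repr q); last exact: reprK.
    by rewrite /= subrr; split; [exact: K10|exact: K20].
  rewrite /open /= /quotient_open.
  rewrite (_ : _ @^-1` _ = \bigcup_(m in [set` L]) [set z | U (z - m - repr q)]).
    apply: bigcup_open => m _.
    have oshift (H : topologicalZmodType) (A : set H) a b : open A ->
        open [set y | A (y - a - b)].
      move=> oA; apply: (@open_comp _ _ (fun y => y - a) [set y | A (y - b)]).
        by move=> ? _; exact: subr_continuous.
      by apply: open_comp => // ? _; exact: subr_continuous.
    rewrite (_ : [set z | _] = [set a | interior K1 (a - m.1 - (repr q).1)] `*`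
        [set a | interior K2 (a - m.2 - (repr q).2)]) //.
    by apply: open_setX; apply: oshift; exact: open_interior.
  apply/seteqP; split => [z [y Uy yz]|z [m mL Uz]].
    exists (z - y); first by apply/pi_eq.
    by rewrite /= opprB addrCA subrr addr0.
  exists (z - m) => //; apply/pi_eq.
  by rewrite addrAC subrr sub0r rpredN.
exists s => x; have [c cs [z [/interior_subset K1z /interior_subset K2z] zx]] := sQ (piQ x) I.
exists c => //; exists (x - z); first by apply/pi_eq.
have xz : x - (x - z) = z by rewrite opprB addrCA subrr addr0.
by split; [have := K1z|have := K2z]; rewrite -{1}xz.
Qed.

End Lattice.

Section ClosedSubgroup.
Variables (G : topologicalZmodType) (H : zmodClosed G).

Lemma val_subgroup_continuous : continuous (val : subgroup H -> G).
Proof. exact: initial_continuous. Qed.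

Lemma nbhs_subgroup (h : subgroup H) (A : set (subgroup H)) : nbhs h A ->
  exists2 B, nbhs (val h) B & val @^-1` B `<=` A.
Proof.
rewrite nbhsE => -[_ [[B oB <-] Bh] BA]; exists B => //.
exact: open_nbhs_nbhs.
Qed.

Hypothesis closedH : closed [set` H].

(** A filter on the subgroup is pushed to the ambient group; its cluster point belongs to [H]
    because [H] is closed. *)
Lemma compact_subgroup_preimage (K : set G) : compact K ->
  compact (val @^-1` K : set (subgroup H)).
Proof.
move=> cK F FF FK.
have FFv : ProperFilter (fmap (val : subgroup H -> G) F) by exact: fmap_proper_filter.
have [x [Kx clx]] := cK _ FFv FK.
have Hx : x \in H.
  apply: closedH => B Bx.
  have [|y [yH By]] := clx [set` H] B _ Bx; last by exists y.
  rewrite /= /fmap /=; have : F [set: subgroup H] by exact: filterT.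
    by apply: filterS => y _; exact: valP.
exists (exist _ x Hx : subgroup H); split => //.
move=> A B FA /nbhs_subgroup[C Cx CB].
have [|_ [[h Ah <-] Ch]] := clx (val @` A) C _ Cx.
  by rewrite /fmap /=; move: FA; apply: filterS => h Ah; exists h.
by exists h; split => //; exact: CB.
Qed.

Lemma hausdorff_subgroup : hausdorff_space G -> hausdorff_space (subgroup H).
Proof.
move=> hG x y xy; apply/val_inj/hG => A B Ax By.
have [h [Ah Bh]] := xy _ _ (val_subgroup_continuous Ax) (val_subgroup_continuous By).
by exists (val h).
Qed.

Lemma lcag_subgroup : lcag G -> lcag (subgroup H).
Proof.
move=> [hG lG [K cK KT]]; split.
- exact: hausdorff_subgroup.
- move=> h _; have [A Ah [cA clA]] := lG (val h) I; exists (val @^-1` A).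
    have nA : nbhs (val h) A.
      by move: Ah; rewrite /within /=; apply: filterS => x; apply.
    have : nbhs h (val @^-1` A) by exact: val_subgroup_continuous.
    by rewrite /within /=; apply: filterS => x Ax _.
  split; first exact: compact_subgroup_preimage.
  by apply: closed_comp => // x _; exact: val_subgroup_continuous.
- exists (fun n => val @^-1` K n) => [n|]; first exact: compact_subgroup_preimage.
  apply/seteqP; split => // h _.
  by have : [set: G] (val h) by []; rewrite -KT => -[n _ Kn]; exists n.
Qed.

End ClosedSubgroup.

Lemma closure_subgroup (V : topologicalZmodType) (A : set V) :
  is_subgroup A -> is_subgroup (closure A).
Proof.
move=> [A0 AB]; split; first exact: subset_closure.
move=> x y /closure_near0 clx /closure_near0 cly; apply/closure_near0 => U U0.
have [U1 [U10 U1N U1D]] := nbhs0_half U0.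
have [a Aa Ua] := clx _ U10; have [b Ab Ub] := cly _ U10.
exists (a - b); first exact: AB.
have -> : x - y - (a - b) = (x - a) + - (y - b).
  by rewrite !opprD !opprK addrACA.
by apply: U1D => //; exact: U1N.
Qed.

Lemma compact_seq_translates (V : topologicalZmodType) (s : seq V) (K : set V) :
  compact K -> compact (mink_add K [set` s]).
Proof.
move=> cK; apply: compact_mink_add => //; apply: finite_compact.
exact: finite_seq.
Qed.

Section Star.
Variables (G Gint : topologicalZmodType) (L : zmodClosed (G * Gint)%type).
Hypothesis injL : {in L &, injective (@fst G Gint)}.
Local Notation st := (star L).

Lemma starE s y : (s, y) \in L -> st s = y.
Proof.
move=> sy; have : [set y | (s, y) \in L] (st s) by apply: xgetPex; exists y.
by move=> /= h; have [] := injL h sy erefl.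
Qed.

Lemma star_in s : proj_lattice L s -> (s, st s) \in L.
Proof. by move=> [[x y] /= xyL <-]; rewrite (starE xyL). Qed.

Lemma starB s t : proj_lattice L s -> proj_lattice L t -> st (s - t) = st s - st t.
Proof. by move=> /star_in Ls /star_in Lt; apply: starE; exact: (rpredB Ls Lt). Qed.

Lemma star0 : st 0 = 0. Proof. by apply: starE; exact: rpred0. Qed.

Lemma starD s t : proj_lattice L s -> proj_lattice L t -> st (s + t) = st s + st t.
Proof. by move=> /star_in Ls /star_in Lt; apply: starE; exact: (rpredD Ls Lt). Qed.

Lemma starMn s n : proj_lattice L s -> st (s *+ n) = st s *+ n.
Proof.
move=> Ls; elim: n => [|n IH]; first by rewrite !mulr0n star0.
rewrite !mulrS starD// ?IH//; apply: (@is_subgroupMz _ _ _ (n%:Z)) => //.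
exact: proj_lattice_subgroup.
Qed.

Lemma cp_set_star W s : cp_set L W s <-> proj_lattice L s /\ W (st s).
Proof.
split=> [[[x y] /= [xyL Wy] <-]|[Ls Ws]]; last first.
  by exists (s, st s) => //; split => //; exact: star_in.
by rewrite (starE xyL); split => //; exists (x, y).
Qed.

End Star.

(** * Finite-index sublattices and their subschemes *)

Section Sublattice.
Variables (G Gint : topologicalZmodType) (L : zmodClosed (G * Gint)%type).
Hypothesis L_cps : cut_and_project L.
Variables (N : set G) (t : seq G).
Hypotheses (sN : is_subgroup N) (NL : N `<=` proj_lattice L).
Hypothesis tL : forall r, r \in t -> proj_lattice L r.
Hypothesis Nt : index_reps (proj_lattice L) N t.

Definition sublattice : set (G * Gint) := [set p | p \in L /\ N p.1].
Local Notation Mt := sublattice.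

Let injL : {in L &, injective (@fst G Gint)}. Proof. by case: L_cps. Qed.

Lemma sublattice_subgroup : is_subgroup Mt.
Proof.
split; first by split; [exact: rpred0|exact: sN.1].
by move=> x y [xL Nx] [yL Ny]; split; [exact: rpredB|exact: sN.2].
Qed.

Lemma sublattice_discrete : exists U V, [/\ nbhs (0 : G) U, nbhs (0 : Gint) V &
    forall p, Mt p -> U p.1 -> V p.2 -> p = 0].
Proof.
case: L_cps => _ _ [iL _] _ _; have [U [V [U0 V0 h]]] := lattice_discrete iL.
by exists U, V; split => // p [pL _]; exact: h.
Qed.

(** A fundamental compact box for [L] is enlarged by the representatives of [L] modulo the
    sublattice, of which there are finitely many. *)
Lemma sublattice_cocompact : exists K1 K2, [/\ compact K1, compact K2 &
  forall x y, exists2 m, Mt m & K1 (x - m.1) /\ K2 (y - m.2)].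
Proof.
case: L_cps => lG lGint [_ cQ] _ _.
have [K1 cK1 K10] := compact_nbhs0 lG; have [K2 cK2 K20] := compact_nbhs0 lGint.
have [s hs] := compact_quotient_cover K10 K20 cQ.
exists (mink_add (mink_add K1 [set` map fst s]) [set` t]).
exists (mink_add (mink_add K2 [set` map snd s]) [set` map (star L) t]).
split; [by do 2 apply: compact_seq_translates|by do 2 apply: compact_seq_translates|].
move=> x y; have [c cs [m mL [K1m K2m]]] := hs (x, y).
have m1L : proj_lattice L m.1 by exists m.
have [r rt Nr] := Nt m1L; have /(star_in injL) rL := tL rt.
exists (m - (r, star L r)); first by split => //; exact: rpredB.
have key (V : zmodType) (a b u v : V) : a - b - v + v + u = a - (b - u).
  by rewrite subrK opprB addrA addrAC.
split.
  exists (x - m.1 - c.1 + c.1); last by exists r => //; exact: key.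
  by exists (x - m.1 - c.1) => //; exists c.1 => //; exact: map_f.
exists (y - m.2 - c.2 + c.2); last first.
  by exists (star L r); [exact: map_f|exact: key].
by exists (y - m.2 - c.2) => //; exists c.2 => //; exact: map_f.
Qed.

(** The union of the finitely many coset closures is closed and contains the dense star image of
    [L]. *)
Lemma sublattice_cosets_dense y : exists2 r, r \in t &
  closure (snd @` Mt) (y - star L r).
Proof.
apply: contrapT => /forall2NP nt; case: L_cps => _ _ _ _ dL.
pose F := \bigcup_(r in [set` t]) translate (star L r) (closure (snd @` Mt)).
have cF : closed F.
  apply: closed_bigcup => [|r _]; first exact: finite_seq.
  by apply: closed_translate; exact: closed_closure.
have [||z [nF [m mL mz]]] := dL (~` F).
- exists y => -[r rt]; rewrite translate_preimage => h.
  by have [] := nt r.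
- exact: closed_openC.
apply: nF; rewrite -{z}mz; have m1L : proj_lattice L m.1 by exists m.
have [r rt Nr] := Nt m1L; exists r => //; rewrite translate_preimage.
apply: subset_closure; exists (m - (r, star L r)) => //; split => //.
by apply: rpredB => //; apply: star_in => //; exact: tL.
Qed.

(** Some coset closure meets a compact set of positive measure in positive measure; translating that
    part back puts it in the closure of the star image. *)
Lemma sublattice_dense (R : realType) (theta : {measure set (borel Gint) -> \bar R}) :
  haar_measure theta -> exists2 B, compact B &
    (0 < theta B)%E /\ B `<=` closure (snd @` Mt).
Proof.
move=> theta_haar; have hGint : hausdorff_space Gint by case: L_cps => _ [].
have [K cK K0] := haar_compact_gt0 theta_haar.
pose E r := translate (star L r) (closure (snd @` Mt)).
have cE r : closed (E r) by apply: closed_translate; exact: closed_closure.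
have mE r : measurable (E r : set (borel Gint)) by exact: borel_closed.
have [||r rt KE] := measure_cover_gt0 (s := t) mE _ _ K0.
- exact: borel_compact.
- move=> y _; have [r rt clr] := sublattice_cosets_dense y.
  by exists r => //; rewrite /E translate_preimage.
have cKE : compact (K `&` E r) by exact: compact_closedI.
exists (translate (- star L r) (K `&` E r)); first exact: compact_translate.
split; first by rewrite (haar_translate theta_haar)//; exact: borel_compact.
move=> _ [y [_ [z clz <-]] <-].
by rewrite addKr.
Qed.

(** [H] is the closure of the star image of the sublattice, and [M] the sublattice itself seen in G
    x H. Density then holds by construction, and closedness of [H] transfers compactness and local
    compactness to it. *)
Lemma sublattice_subscheme : exists (H : zmodClosed Gint)
    (M : zmodClosed (G * subgroup H)%type),
  [/\ cp_subscheme L M, proj_lattice M = N, closed [set` H],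
    (forall p, p \in M <-> Mt (p.1, val p.2)) &
    (forall p, Mt p -> exists h : subgroup H, val h = p.2)].
Proof.
have [lG lGint latL _ dL] := L_cps; have [hG _ _] := lG.
have sMt : is_subgroup (snd @` Mt).
  have [M0 MB] := sublattice_subgroup.
  split=> [|_ _ [x Mx <-] [y My <-]]; first by exists 0.
  by exists (x - y) => //; exact: MB.
have [H HE] := zmodClosed_of_subgroup (closure_subgroup sMt).
have cH : closed [set` H].
  rewrite (_ : [set` H] = closure (snd @` Mt)); first exact: closed_closure.
  by apply/seteqP; split => y /HE.
have [M ME] : exists M : zmodClosed (G * subgroup H)%type,
    forall p, p \in M <-> Mt (p.1, val p.2).
  apply: (@zmodClosed_of_subgroup _ [set p | Mt (p.1, val p.2)]).
  have [M0 MB] := sublattice_subgroup.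
  split; first exact: M0.
  by move=> x y /= Mx My; exact: (MB _ _ Mx My).
have lift p : Mt p -> exists h : subgroup H, val h = p.2.
  move=> Mp; have Hp : p.2 \in H by apply/HE/subset_closure; exists p.
  by exists (exist _ p.2 Hp).
have projM : proj_lattice M = N.
  apply/seteqP; split => [_ [p /ME[_ Np] <-]//|x Nx].
  have [[x' y] /= xyL xx'] := NL Nx; rewrite -{}xx' in Nx *.
  have Mxy : Mt (x', y) by [].
  have [h hy] := lift _ Mxy; exists (x', h) => //.
  by apply/ME; rewrite /= hy.
exists H, M; split => //; split; last by move=> p /ME[].
split => //.
- exact: lcag_subgroup.
- split.
    apply: lattice_isolated; have [U [V [U0 V0 UV]]] := sublattice_discrete.
    exists U, (val @^-1` V); split => //.
      exact: (@val_subgroup_continuous _ H 0).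
    move=> p /ME Mp Up Vp; have [p1 p2] := UV _ Mp Up Vp.
    by case: p p1 p2 {Mp Up Vp} => a h /= -> h0; congr pair; exact: val_inj.
  have [K1 [K2 [cK1 cK2 cov]]] := sublattice_cocompact.
  have cK : compact (K1 `*` (val @^-1` K2 : set (subgroup H))).
    by apply: compact_setX => //; exact: compact_subgroup_preimage.
  pose piM := \pi_(quotient_topology (Quotient.quot M))%qT :
    G * subgroup H -> quotient_topology (Quotient.quot M).
  (* The quotient is the image of a compact box that meets every class. *)
  rewrite (_ : setT = piM @` (K1 `*` (val @^-1` K2 : set (subgroup H)))).
    apply: continuous_compact => //; apply: continuous_subspaceT.
    exact: pi_continuous.
  apply/seteqP; split => // q _; rewrite -[q]reprK.
  have [m Mm [K1m K2m]] := cov (repr q).1 (val (repr q).2).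
  have [h hm] := lift _ Mm.
  exists (repr q - (m.1, h)).
    split; first exact: K1m.
    have valB : val ((repr q).2 - h) = val (repr q).2 - val h by exact: raddfB.
    by rewrite /preimage /mkset valB hm.
  apply/pi_eq; rewrite addrAC subrr sub0r rpredN.
  by apply/ME; rewrite /= hm -surjective_pairing.
- move=> [a h] [b k] /ME[xL _] /ME[yL _] /= ab.
  by have [_ hk] := injL xL yL ab; rewrite ab (val_inj hk).
- move=> Y [h Yh] oY; have [B Bh BY] := nbhs_subgroup (open_nbhs_nbhs (conj oY Yh)).
  have /HE clh : val h \in H by exact: valP.
  have [_ [[m Mm <-] Bm]] := clh _ Bh; have [k km] := lift _ Mm.
  exists k; split; first by apply: BY; rewrite /preimage /= km.
  by exists (m.1, k) => //; apply/ME; rewrite /= km -surjective_pairing.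
Qed.

End Sublattice.

(** * Run lengths *)

Section Runs.
Variable V : topologicalZmodType.
Implicit Types (A : set V) (x s : V) (k : nat).

(** For nonzero [x], the points [s] of [A] with [ell_at] equal to [k]. *)
Definition exact_run A x k : set V :=
  [set s | (forall n, (n <= k)%N -> A (s - x *+ n)) /\ ~ A (s - x *+ k.+1)].

Lemma exact_run_sub A x k : exact_run A x k `<=` A.
Proof. by move=> s [/(_ 0%N isT) + _]; rewrite mulr0n subr0. Qed.

Lemma exact_run_inj A x k k' s : exact_run A x k s -> exact_run A x k' s -> k = k'.
Proof.
move=> [h1 n1] [h2 n2]; apply/eqP; rewrite eqn_leq; apply/andP; split.
  by rewrite leqNgt; apply/negP => /h1.
by rewrite leqNgt; apply/negP => /h2.
Qed.

(** A run of [k] steps from s - x would prolong the run from [s] to k + 1 steps. *)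
Lemma exact_run_sub_step A x k s : exact_run A x k s -> ~ exact_run A x k (s - x).
Proof. by move=> [_ nA] [/(_ k (leqnn k)) + _]; rewrite -addrA -opprD -mulrS. Qed.

(** An endless run would make [ell] infinite at a nonzero difference of points of [A], against
    finite periodicity. So some s - n x leaves [A], and the predecessor of the least such [n] is the
    run length. *)
Lemma exact_run_exists (R : realType) A x s : finitely_periodic R A -> x != 0 ->
  A s -> exists2 k, exact_run A x k s & (k%:R%:E <= ell R A x)%E.
Proof.
move=> fpA x0 As.
have ell_ge k : (forall n, (n <= k)%N -> A (s - x *+ n)) -> (k%:R%:E <= ell R A x)%E.
  move=> h; apply: le_trans (_ : ell_at R A x s <= _)%E; last first.
    by apply: ereal_sup_ubound; exists s.
  by rewrite /ell_at (negbTE x0); apply: ereal_sup_ubound; exists k.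
have exn : exists n, `[< ~ A (s - x *+ n) >].
  apply: contrapT => /forallNP hA.
  have {}hA n : A (s - x *+ n) by apply: contrapT => /asboolP; exact: hA.
  have Asx : A (s - x) by have := hA 1%N; rewrite mulr1n.
  have lfin : (ell R A x < +oo)%E.
    by apply: fpA; exists s => //; exists (s - x) => //; rewrite opprB addrCA subrr addr0.
  have : (0%:R%:E <= ell R A x)%E by apply: ell_ge => n _.
  move: lfin ell_ge; case: (ell R A x) => // r _ ell_ge _.
  have := ell_ge (Num.truncn r).+1 (fun n _ => hA n).
  by rewrite lee_fin leNgt truncnS_gt.
have [m /asboolP mA mmin] := ex_minnP exn.
case: m mA mmin => [|k] mA mmin; first by rewrite mulr0n subr0 in mA.
have kA i : (i <= k)%N -> A (s - x *+ i).
  move=> ik; apply: contrapT => /asboolP/mmin; rewrite leqNgt.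
  by rewrite ltnS ik.
by exists k => //; exact: ell_ge.
Qed.

Lemma ell0 (R : realType) A : A !=set0 -> ell R A 0 = 0%E.
Proof.
move=> [s As]; rewrite /ell (_ : [set _ | _ in _] = [set 0%E]) ?ereal_sup1//.
apply/seteqP; split => [_ [y _ <-]|_ ->]; first by rewrite /ell_at eqxx.
by exists s => //; rewrite /ell_at eqxx.
Qed.

End Runs.

(** * Sets with null boundary *)

Section NullBoundary.
Variables (R : realType) (G : topologicalZmodType).
Variable theta : {measure set (borel G) -> \bar R}.
Hypothesis theta_haar : haar_measure theta.
Implicit Types (A B : set G) (x : G).

Definition null_boundary A := theta (frontier A) = 0%E.

Lemma borel_frontier A : measurable (frontier A : set (borel G)).
Proof.
apply: borel_closed; rewrite /frontier setDE -closure_setC.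
by apply: closedI; exact: closed_closure.
Qed.

Lemma null_boundaryC A : null_boundary A -> null_boundary (~` A).
Proof. by rewrite /null_boundary frontierC. Qed.

Lemma null_boundaryI A B :
  null_boundary A -> null_boundary B -> null_boundary (A `&` B).
Proof.
move=> A0 B0; apply/eqP; rewrite -measure_le0.
have mf := borel_frontier.
apply: le_trans (_ : theta (frontier A `|` frontier B) <= _)%E.
  apply: measure_mono; [exact: mf| |exact: frontierI].
  exact: (@measurableU _ (borel G)).
have <- : (theta (frontier A) + theta (frontier B) = 0)%E.
  by rewrite A0 B0 adde0.
exact: (measureU2 theta (mf A) (mf B)).
Qed.

Lemma null_boundary_shift x A : null_boundary A -> null_boundary (shift x A).
Proof.
have -> : shift x A = translate (- x) A.
  by rewrite translate_preimage; apply/funext => y; rewrite /preimage /= opprK.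
rewrite /null_boundary frontier_translate (haar_translate theta_haar)//.
exact: borel_frontier.
Qed.

(** An exact run set is a finite intersection of shifts of [A] with the complement of one more
    shift. *)
Lemma null_boundary_exact_run A x k :
  null_boundary A -> null_boundary (exact_run A x k).
Proof.
move=> A0; rewrite (_ : exact_run A x k =
  [set s | forall n, (n <= k)%N -> A (s - x *+ n)] `&`
  ~` shift (- (x *+ k.+1)) A)//.
apply: null_boundaryI; last exact/null_boundaryC/null_boundary_shift.
elim: k => [|k IH].
  rewrite (_ : [set s | _] = A)//; apply/seteqP; split => s /=.
    by move=> /(_ 0%N isT); rewrite mulr0n subr0.
  by move=> As n; rewrite leqn0 => /eqP->; rewrite mulr0n subr0.
rewrite (_ : [set s | _] = [set s | forall n, (n <= k)%N -> A (s - x *+ n)] `&`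
  shift (- (x *+ k.+1)) A).
  by apply: null_boundaryI => //; exact: null_boundary_shift.
apply/seteqP; split => s /=.
  by move=> h; split => [n nk|]; apply: h => //; exact: leqW.
by move=> [h hk] n; rewrite leq_eqVlt ltnS => /orP[/eqP->//|]; exact: h.
Qed.

End NullBoundary.

(** The star map is additive on [L], so cutting the model set by run length amounts to cutting its
    window by run length. *)
Lemma exact_run_star (G Gint : topologicalZmodType) (L : zmodClosed (G * Gint)%type)
    (W : set Gint) (x s : G) (k : nat) :
  {in L &, injective (@fst G Gint)} -> proj_lattice L x -> proj_lattice L s ->
  exact_run W (star L x) k (star L s) <-> exact_run (cp_set L W) x k s.
Proof.
move=> injL Lx Ls; have sL := proj_lattice_subgroup L.
have Lxn n : proj_lattice L (x *+ n) := is_subgroupMz n%:Z sL Lx.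
have Lsn n : proj_lattice L (s - x *+ n) by exact: sL.2.
have key n : W (star L s - star L x *+ n) <-> cp_set L W (s - x *+ n).
  rewrite cp_set_star// starB// starMn//; split=> [|[]//]; by split.
by split=> -[h nh]; split=> [n /h/key|/key].
Qed.

Lemma precompact_subgroup_preimage (G : topologicalZmodType) (H : zmodClosed G)
    (A : set G) : hausdorff_space G -> closed [set` H] -> bdd A ->
  precompact (val @^-1` A : set (subgroup H)).
Proof.
move=> hG cH [K cK AK]; exists (val @^-1` K); first by move=> h /AK.
split; first exact: compact_subgroup_preimage.
apply: closed_comp => [h _|]; first exact: val_subgroup_continuous.
exact: compact_closed.
Qed.

(** * Decomposition of the model set into independent pieces *)

Theorem theorem1 (R : realType) (G Gint : topologicalZmodType)
    (mu : {measure set (borel G) -> \bar R})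
    (theta : {measure set (borel Gint) -> \bar R})
    (Dn : nat -> set G)
    (L : zmodClosed (G * Gint)%type)
    (W : set Gint)
    (d : measure_display) (T : measurableType d) (P : probability T R)
    (X : G -> T -> R[i])
    (mu_haar : haar_measure mu)
    (theta_haar : haar_measure theta)
    (Dn_vH : van_Hove mu Dn)
    (L_cps : cut_and_project L)
    (L_fg : finitely_generated (proj_lattice L))
    (W_window : window W)
    (W_fp : finitely_periodic R (cp_set L W))
    (X_fr : finitely_randomized P X (cp_set L W)) :
  exists (H : zmodClosed Gint) (M : zmodClosed (G * subgroup H)%type)
         (rep : set G -> G),
    let LM := quotient_set (proj_lattice L) (proj_lattice M) in
    [/\ cp_subscheme L M,
        (forall C, LM C -> C (rep C)),
        finite_set [set rep C | C in LM] &
        forall g r : G,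
          mink_sub (cp_set L W) (cp_set L W) g ->
          [set rep C | C in LM] r ->
          proj_lattice M (r - g) ->
          let l := ell R (cp_set L W) (g - r) in
          exists V : set G -> nat -> set (subgroup H),
            let S C k := translate (rep C) (cp_set M (V C k)) in
            [/\ forall C k, LM C -> (k%:R%:E <= l)%E ->
                  [/\ precompact (V C k),
                      val @` V C k `<=` translate (- star L (rep C)) W,
                      independent_family P
                        (fun s w => X s w * (X (s - g) w)^*%C)
                        [set s | S C k s /\ cp_set L W (s - g)] &
                      theta (frontier W) = 0%E ->
                        exists dens : R,
                          (counting (S C k `&` Dn n) / mu (Dn n))%E
                            @[n --> \oo] --> dens%:E],
                cp_set L W =
                  \bigcup_(p in [set p : set G * nat |
                                 LM p.1 /\ (p.2%:R%:E <= l)%E]) S p.1 p.2 &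
                trivIset [set p : set G * nat |
                          LM p.1 /\ (p.2%:R%:E <= l)%E]
                         (fun p => S p.1 p.2)]].
Proof.

have [lG lGint latL injL dL] := L_cps.
have [hG _ _] := lG; have [hGint _ _] := lGint.
have [_ [D finD dD]] := X_fr; have [DN DS indepD] := dD.
set La := cp_set L W; set L1 := proj_lattice L.
have sL1 : is_subgroup L1 := proj_lattice_subgroup L.
have LaL : La `<=` L1 by move=> _ [p [pL _] <-]; exists p.
(* With [0] in the list, [avoid] also keeps nonzero elements of [D] out of [N]. *)
pose D0 : seq G := 0 :: enum_fset (fset_set D).
have D0D a : D a -> a \in D0 by move=> Da; rewrite inE in_fset_set// mem_set ?orbT.
pose l := [seq a <- [seq a - b | a <- D0, b <- D0] | a != 0].
have l0 : 0 \notin l by rewrite mem_filter eqxx.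
have [N [t [sN NL tL Nt Nl]]] := finite_index_avoid sL1 L_fg l0.
have avoid a b : a \in D0 -> b \in D0 -> N (a - b) -> a = b.
  move=> aD bD Nab; apply/eqP; rewrite -subr_eq0; apply/negPn/negP => ab.
  by apply: Nl Nab; rewrite mem_filter ab; apply/allpairsP; exists (a, b).
have [H [M [subM projM cH ME lift]]] := sublattice_subscheme L_cps sN NL tL Nt.
(* A coset meets D at most once; the representative is this point whenever it
   exists. *)
pose rep (C : set G) := xget (xget 0 C) (C `&` D).
exists H, M, rep => LM.
have cosetE C : LM C -> exists2 s, L1 s & forall a, C a <-> N (a - s).
  move=> [s Ls <-]; exists s => // a.
  by rewrite projM translate_preimage.
have LML C a : LM C -> C a -> L1 a.
  move=> /cosetE[s Ls CE] /CE/NL La'.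
  by rewrite -(subrK s a); exact: is_subgroupD.
have cosetB C a b : LM C -> C a -> (C b <-> N (b - a)).
  move=> /cosetE[s Ls CE] /CE Na; rewrite CE; split=> Nb.
    by have := sN.2 _ _ Nb Na; rewrite opprB addrA subrK.
  by have := is_subgroupD sN Nb Na; rewrite addrA subrK.
have repC C : LM C -> C (rep C).
  move=> LMC; rewrite /rep; case: xgetP => [y _ []//|_].
  have [s Ls CE] := cosetE C LMC; apply: (@xgetPex _ 0 C).
  by exists s; apply/CE; rewrite subrr; exact: sN.1.
have repD C a : LM C -> C a -> D a -> D (rep C).
  by move=> LMC Ca Da; have [] : (C `&` D) (rep C) by apply: xgetPex; exists a.
split => //.
  rewrite (_ : [set rep C | C in LM] =
      [set rep C | C in [set translate r N | r in [set` t]] `&` LM]).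
    apply: finite_image; apply: sub_finite_set (@subIsetl _ _ _) _.
    by apply: finite_image; exact: finite_seq.
  apply/seteqP; split => [_ [C LMC <-]|_ [C [_ LMC] <-]]; last by exists C.
  exists C => //; split => //; have [s Ls CE] := cosetE C LMC.
  have [r rt Nsr] := Nt s Ls; exists r => //; apply/seteqP; split => a.
    rewrite translate_preimage => Nar; apply/CE.
    by have := sN.2 _ _ Nar Nsr; rewrite opprB addrA subrK.
  move=> /CE Nas; rewrite translate_preimage.
  by have := is_subgroupD sN Nas Nsr; rewrite addrA subrK.
move=> g r Lag [C0 LMC0 repC0] Nrg; rewrite projM in Nrg.
move=> ell_; pose x := g - r.
have Nx : N x by rewrite /x -opprB; exact: is_subgroupN.
have Lx : L1 x by exact: NL.
(* For x = 0 there is no maximal run, and the only admissible k is 0. *)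
pose Wk k := if x == 0 then W else exact_run W (star L x) k.
pose Lk k := if x == 0 then La else exact_run La x k.
have WLk k s : L1 s -> Wk k (star L s) <-> Lk k s.
  move=> Ls; rewrite /Wk /Lk; case: ifP => _; last exact: exact_run_star.
  by rewrite /La cp_set_star//; split=> [|[]].
have LkLa k : Lk k `<=` La.
  by rewrite /Lk; case: ifP => _ //; exact: exact_run_sub.
have WkW k : Wk k `<=` W.
  by rewrite /Wk; case: ifP => _ //; exact: exact_run_sub.
have La0 : La !=set0 by case: Lag => a; exists a.
exists (fun C k => [set h | Wk k (val h + star L (rep C))]) => S.
(* Shifting the window by the star of [rep C] makes [S C k] exactly the part of the coset [C] in
   [Lk k]; independence, covering and disjointness rest on this description. *)
have SE C k s : LM C -> S C k s <-> C s /\ Lk k s.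
  move=> LMC; have Cr := repC C LMC; have Lr := LML C _ LMC Cr; split.
    move=> [_ [p [/ME[pL Np] Wp] <-] <-].
    have Ls : L1 (rep C + p.1) by apply: is_subgroupD => //; exact: NL.
    split; first by apply/(cosetB C _ _ LMC Cr); rewrite addrAC subrr add0r.
    apply/WLk => //; rewrite starD//; last exact: NL.
    by rewrite (starE injL pL) addrC.
  move=> [Cs Lks]; have Ls := LML C s LMC Cs.
  have Ns := (cosetB C _ s LMC Cr).1 Cs.
  exists (s - rep C); last by rewrite addrC subrK.
  have Mt : sublattice L N (s - rep C, star L (s - rep C)).
    by split => //; apply: star_in => //; exact: NL.
  have [h hE] := lift _ Mt; exists (s - rep C, h) => //; split.
    by apply/ME; rewrite hE.
  by rewrite /= hE starB// subrK; exact/WLk.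
(* The point s - u + g lies in the coset [C0] of [r]. If it is in [D], then so is [r], and [avoid]
   identifies the two: s = u - x, contradicting equal run lengths, or s <> u when x = 0. *)
have dist C k s u : S C k s -> S C k u -> LM C -> s != u -> D (s - u + g) -> False.
  move=> /SE + /SE + LMC; move=> /(_ LMC)[Cs Lks] /(_ LMC)[Cu Lku] su Dd.
  have Nd : N (s - u + g - r).
    by rewrite -addrA; apply: is_subgroupD => //; exact: (cosetB C _ _ LMC Cu).1.
  have Cd : C0 (s - u + g).
    by apply/(cosetB C0 _ _ LMC0 (repC C0 LMC0)); rewrite repC0.
  have Dr : D r by rewrite -repC0; exact: repD Cd Dd.
  have := avoid _ _ (D0D _ Dd) (D0D _ Dr) Nd => sug.
  have sE : s = u - x.
    by rewrite /x -sug opprB addrK addrC subrK.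
  move: su Lks Lku; rewrite /Lk sE; case: ifP => [/eqP->|_ _ h1 h2].
    by rewrite subr0 eqxx.
  exact: exact_run_sub_step h2 h1.
have bW : bdd W by case: W_window => _ _ [U WU [cU _]]; exists U.
split.
- move=> C k LMC kl; pose A := shift (star L (rep C)) (Wk k).
  have bA : bdd A by apply: bdd_shift; exact: bddS (@WkW k) bW.
  have inv s u : S C k s -> S C k u -> N (s - u).
    move=> /(SE C k s LMC)[Cs _] /(SE C k u LMC)[Cu _].
    exact: (cosetB C u s LMC Cu).1.
  split.
  + exact: (precompact_subgroup_preimage hGint cH bA).
  + move=> _ [h Wh <-]; exists (val h + star L (rep C)); first exact: WkW Wh.
    by rewrite addrC addrK.
  + apply: independent_products dD _ _ => [s [/(SE C k s LMC)[_ /LkLa]]//|].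
    move=> s u [Ss _] [Su _] su; split => Dd.
    * have := avoid _ 0 (D0D _ Dd) (mem_head _ _); rewrite subr0.
      by move=> /(_ (inv _ _ Ss Su))/eqP; rewrite subr_eq0 (negbTE su).
    * exact: dist Ss Su LMC su Dd.
    (* The symmetry of [D] reduces s - u - g to the previous case with [s] and [u] exchanged. *)
    * apply: (dist _ _ _ _ Su Ss LMC); first by rewrite eq_sym.
      by rewrite DN; exists (s - u - g) => //; rewrite !opprD !opprK (addrC (- s)).
  + move=> thW; have thA : theta (frontier A) = 0%E.
      apply: null_boundary_shift => //; rewrite /Wk; case: ifP => _ //.
      exact: null_boundary_exact_run.
    (* The density is computed in [Gint] with [theta], for the sublattice and the window [A]; adding
       [rep C] maps the points counted there bijectively onto those of [S C k] in [Dn n]. *)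
    have sM := sublattice_subgroup L sN.
    have dM := sublattice_discrete L_cps N.
    have [dens hdens] := shifted_density_exists lG lGint mu_haar Dn_vH sM dM
      theta_haar (sublattice_dense L_cps tL Nt theta_haar)
      (sublattice_cocompact L_cps tL Nt) (rep C) bA thA.
    exists dens.
    rewrite (_ : (fun n => _) = EFin \o
        (fun n => nb R (pts (sublattice L N) (shift (rep C) (Dn n)) A) / dn mu Dn n)).
      exact: cvg_comp hdens _.
    apply/funext => n /=.
    have fpts : finite_set (pts (sublattice L N) (shift (rep C) (Dn n)) A).
      apply: (finite_pts lG mu_haar sM dM) => //.
      by apply: bdd_shift; exact: bdd_D Dn_vH n.
    have -> : S C k `&` Dn n = (fun p => p.1 + rep C) @`
        pts (sublattice L N) (shift (rep C) (Dn n)) A.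
      apply/seteqP; split => [s [[_ [p [/ME Mp Wp] <-] <-] Dp]|_ [p [Mp Dp Wp] <-]].
        exists (p.1, val p.2); last by rewrite addrC.
        by split => //; rewrite /shift /= addrC.
      split => //; have [h hp] := lift _ Mp; exists p.1; last by rewrite addrC.
      exists (p.1, h) => //; split; last by rewrite /= hp.
      by apply/ME; rewrite /= hp -surjective_pairing.
    rewrite /counting asboolT; last exact: finite_image.
    rewrite -/(nb R _) nb_image//; last first.
      move=> p q /set_mem[[pL _] _ _] /set_mem[[qL _] _ _] /addIr.
      exact: injL.
    have mDn : mu (Dn n) = (dn mu Dn n)%:E by exact: mu_D.
    by rewrite mDn inver gt_eqF ?dn_gt0.
- apply/seteqP; split => [s Las|s [[C k] /= [LMC kl] /(SE C k s LMC)[_ /LkLa]]//].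
  have Ls : L1 s by exact: LaL.
  pose C := translate s (proj_lattice M).
  have LMC : LM C by exists s.
  have Cs : C s by rewrite /C projM translate_preimage /preimage /= subrr; exact: sN.1.
  have [x0|x0] := eqVneq x 0.
    exists (C, 0%N); first by split => //; rewrite /ell_ -/x x0 ell0.
    by apply/(SE C 0%N s LMC); split => //; rewrite /Lk x0 eqxx.
  have [k rk kl] := exact_run_exists W_fp x0 Las.
  exists (C, k); first by split.
  by apply/(SE C k s LMC); split => //; rewrite /Lk (negbTE x0).
- move=> [C k] [C' k'] /= [LMC kl] [LMC' kl'] [s []].
  move=> /(SE C k s LMC)[Cs Lks] /(SE C' k' s LMC')[Cs' Lks'].
  congr pair.
    apply/seteqP; split => a.
      by move=> /(cosetB C s a LMC Cs) ?; apply/(cosetB C' s a LMC' Cs').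
    by move=> /(cosetB C' s a LMC' Cs') ?; apply/(cosetB C s a LMC Cs).
  move: Lks Lks'; rewrite /Lk; case: ifP => [/eqP x0 _ _|_]; last exact: exact_run_inj.
  have k0 j : (j%:R%:E <= ell_)%E -> j = 0%N.
    by rewrite /ell_ -/x x0 ell0// lee_fin lern0 => /eqP.
  by rewrite (k0 _ kl) (k0 _ kl').
Qed.
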